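(* Let $\Bbbk$ be a perfect field of characteristic $p>0$, and let $R(1),\ldots,R(n)$ be Noetherian standard graded rings over $\Bbbk$, each of dimension $\geq 2$. For each $i$ let $I(i)$ be a homogeneous ideal of $R(i)$ of finite colength. Let $I(1)\boxtimes\cdots\boxtimes I(n)$ be the homogeneous ideal $$\sum_{i=1}^n R(1)\otimes\cdots\otimes R(i-1)\otimes I(i)\otimes R(i+1)\otimes\cdots\otimes R(n)$$ of $\bigotimes_{i} R(i)=R(1)\otimes_{\Bbbk}\cdots\otimes_{\Bbbk}R(n)$. Then, viewing Hilbert-Kunz density functions as functions on $\mathbb{R}$, $$f_{\otimes_i R(i),\,\boxtimes_i I(i)}=f_{R(1),I(1)}*\cdots*f_{R(n),I(n)},$$ where $*$ denotes convolution of integrable functions on $\mathbb{R}$.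
   Context: All tensor products are over $\Bbbk$. A standard graded ring over $\Bbbk$ is a commutative $\mathbb{N}$-graded ring $R=\bigoplus_{m\ge 0}R_m$ with $R_0=\Bbbk$, generated as a $\Bbbk$-algebra by finitely many elements of $R_1$. The tensor product of such rings carries the total grading. An ideal $I\subset R$ has finite colength if $R/I$ has finite length. For $q=p^n$, $I^{[q]}$ denotes the ideal generated by the $q$-th powers of the elements of $I$. For a graded module $M$, $\ell(M)_m$ denotes the length (equivalently, $\Bbbk$-dimension) of the degree $m$ component of $M$. Hilbert-Kunz density function: let $R$ be a standard graded ring of dimension $d\ge 2$ over a perfect field of characteristic $p>0$ and $I$ a homogeneous ideal of finite colength. For $q=p^n$ let $f_n(R,I):[0,\infty)\to[0,\infty)$ be $f_n(R,I)(x)=\frac{1}{q^{d-1}}\,\ell(R/I^{[q]})_{\lfloor qx\rfloor}$. It is known (Trivedi) that $f_n(R,I)$ converges uniformly, as $n\to\infty$, to a compactly supported continuous function $f_{R,I}:[0,\infty)\to[0,\infty)$, called the Hilbert-Kunz density function of $(R,I)$. It is considered as a continuous function on $\mathbb{R}$ by setting its value to $0$ on $(-\infty,0]$. Convolution: for integrable $f,g:\mathbb{R}\to\mathbb{R}$, $(f*g)(x)=\int_{-\infty}^{\infty}f(y)g(x-y)\,dy$; this operation is commutative and associative. *)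

(* Defs.v *)
From HB Require Import structures.
From mathcomp Require Import all_boot all_order all_algebra.
From mathcomp Require Import all_classical all_reals all_analysis.

Set Implicit Arguments.
Unset Strict Implicit.
Unset Printing Implicit Defensive.

Import Order.TTheory GRing.Theory Num.Theory.
Import numFieldNormedType.Exports.

Local Open Scope classical_set_scope.
Local Open Scope ring_scope.

(* Perfectness in characteristic p: the Frobenius is surjective. *)
Definition perfect_field (p : nat) (k : fieldType) : Prop :=
  p \in [pchar k] /\ forall a : k, exists b : k, b ^+ p = a.

(* Unlike the library's [idealr_closed], this allows the unit ideal. *)
Definition is_ideal (A : comNzRingType) (I : set A) : Prop :=
  [/\ I 0, forall a b, I a -> I b -> I (a + b) & forall a b, I b -> I (a * b)].

Definition ideal_gen (A : comNzRingType) (S : set A) : set A :=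
  smallest (@is_ideal A) S.

Definition noetherian (A : comNzRingType) : Prop :=
  forall I : set A, is_ideal I -> exists s : seq A, I = ideal_gen [set` s].

Definition is_prime (A : comNzRingType) (P : set A) : Prop :=
  idealr_closed [in P] /\ prime_idealr_closed [in P].

Definition has_prime_chain (A : comNzRingType) (d : nat) : Prop :=
  exists P : nat -> set A,
    (forall i, (i <= d)%N -> is_prime (P i)) /\
    (forall i, (i < d)%N -> P i `<` P i.+1).

(* The value is a junk 0 when the chains of primes have unbounded length. *)
Definition krull_dim (A : comNzRingType) : nat :=
  xget 0%N [set d | has_prime_chain A d /\ ~ has_prime_chain A d.+1].

(* The submodules of A/I are the ideals of A containing I, so this says that
   the A-module A/I has finite length. *)
Definition finite_colength (A : comNzRingType) (I : set A) : Prop :=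
  exists N : nat, ~ exists J : nat -> set A,
    (forall i, (i <= N)%N -> is_ideal (J i) /\ I `<=` J i) /\
    (forall i, (i < N)%N -> J i `<` J i.+1).

Definition frobenius_power (A : comNzRingType) (I : set A) (q : nat) : set A :=
  ideal_gen [set a ^+ q | a in I].

Definition lspan (k : fieldType) (V : lmodType k) (S : set V) : set V :=
  smallest (fun W : set V => submod_closed [in W]) S.

Definition is_basis_mod (k : fieldType) (V : lmodType k) (U W : set V)
    (n : nat) (e : 'I_n -> V) : Prop :=
  [/\ forall i, U (e i),
      forall u, U u -> exists c : 'I_n -> k, W (u - \sum_i c i *: e i)
    & forall c : 'I_n -> k, W (\sum_i c i *: e i) -> forall i, c i = 0].

(* Dimension of U / (U `&` W) for subspaces U and W (0 if infinite). *)
Definition dim_mod (k : fieldType) (V : lmodType k) (U W : set V) : nat :=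
  xget 0%N [set n | exists e : 'I_n -> V, is_basis_mod U W e].

Record standard_graded (k : fieldType) (A : comAlgType k) (G : nat -> set A)
    : Prop := StandardGraded {
  sg_submod : forall m, submod_closed [in G m];
  sg_mul : forall m m' a b, G m a -> G m' b -> G (m + m')%N (a * b);
  sg_span : forall a, exists N (c : nat -> A),
    (forall m, G m (c m)) /\ a = \sum_(m < N) c m;
  sg_direct : forall N (c : nat -> A), (forall m, G m (c m)) ->
    \sum_(m < N) c m = 0 -> forall m, (m < N)%N -> c m = 0;
  sg_deg0 : G 0%N = [set c%:A | c in [set: k]];
  sg_gen : exists s : seq A, [set` s] `<=` G 1%N /\
    smallest (fun B : set A => subalg_closed [in B]) [set` s] = [set: A]
}.

Definition homogeneous_ideal (k : fieldType) (A : comAlgType k)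
    (G : nat -> set A) (I : set A) : Prop :=
  is_ideal I /\ forall a, I a -> exists N (c : nat -> A),
    (forall m, G m (c m) /\ I (c m)) /\ a = \sum_(m < N) c m.

Definition multilinear_map (k : fieldType) (n : nat) (R : 'I_n -> comAlgType k)
    (V : lmodType k) (g : (forall i, R i) -> V) : Prop :=
  forall i (x : forall j, R j), linear (fun a : R i => g (dfwith x i a)).

(* T is the tensor product of the k-algebras R i, with tens x the pure tensor
   x_0 (x) ... (x) x_(n-1): tens is the universal k-multilinear map, and
   multiplication is componentwise on pure tensors. *)
Definition is_tensor_product (k : fieldType) (n : nat)
    (R : 'I_n -> comAlgType k) (T : comAlgType k)
    (tens : (forall i, R i) -> T) : Prop :=
  [/\ multilinear_map tens,
      forall (V : lmodType k) (g : (forall i, R i) -> V), multilinear_map g ->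
        exists2 h : {linear T -> V}, (forall x, h (tens x) = g x) &
          forall h' : {linear T -> V}, (forall x, h' (tens x) = g x) -> h' =1 h,
      tens (fun i => 1) = 1
    & forall x y, tens (fun i => x i * y i) = tens x * tens y].

Definition tensor_grading (k : fieldType) (n : nat) (R : 'I_n -> comAlgType k)
    (T : comAlgType k) (tens : (forall i, R i) -> T)
    (G : forall i, nat -> set (R i)) (m : nat) : set T :=
  lspan [set t | exists (e : 'I_n -> nat) (x : forall i, R i),
    [/\ (\sum_i e i)%N = m, forall i, G i (e i) (x i) & t = tens x]].

(* R_0 (x) ... (x) I_i (x) ... (x) R_(n-1) as a subspace of the tensor product *)
Definition slot_ideal (k : fieldType) (n : nat) (R : 'I_n -> comAlgType k)
    (T : comAlgType k) (tens : (forall i, R i) -> T) (i : 'I_n)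
    (I : set (R i)) : set T :=
  lspan [set tens x | x in [set x : forall j, R j | I (x i)]].

Definition box_ideal (k : fieldType) (n : nat) (R : 'I_n -> comAlgType k)
    (T : comAlgType k) (tens : (forall i, R i) -> T)
    (I : forall i, set (R i)) : set T :=
  [set t | exists s : 'I_n -> T,
    (forall i, slot_ideal tens (I i) (s i)) /\ t = \sum_i s i].

(* I^[q] being homogeneous, the degree m component of A/I^[q] is
   G m / (G m `&` I^[q]). *)
Definition hk_seq (K : realType) (p : nat) (k : fieldType) (A : comAlgType k)
    (G : nat -> set A) (I : set A) (n : nat) (x : K) : K :=
  let q := (p ^ n)%N in
  (q%:R ^+ (krull_dim A).-1)^-1 *
  (dim_mod (G (Num.truncn (q%:R * x))) (frobenius_power I q))%:R.

Definition is_hk_density (K : realType) (p : nat) (k : fieldType)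
    (A : comAlgType k) (G : nat -> set A) (I : set A) (f : K -> K) : Prop :=
  [/\ {uniform [set x : K | 0 <= x], hk_seq p G I @ \oo --> f},
      forall x, x <= 0 -> f x = 0,
      continuous f
    & compact (closure [set x | f x != 0])].

Lemma is_hk_density_unique (K : realType) (p : nat) (k : fieldType)
    (A : comAlgType k) (G : nat -> set A) (I : set A) (f g : K -> K) :
  is_hk_density p G I f -> is_hk_density p G I g -> f = g.
Proof.
move=> [cf f0 _ _] [cg g0 _ _]; apply/funext => x.
have [x0|/ltW x0] := leP x 0; first by rewrite f0 ?g0.
have cvgx h : {uniform [set x : K | 0 <= x], hk_seq p G I @ \oo --> h} ->
    (hk_seq p G I n x : K) @[n --> \oo] --> h x.
  move=> ch.
  have /uniform_subset_cvg/(_ ch) : [set x] `<=` [set x : K | 0 <= x].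
    by move=> _ ->.
  by rewrite uniform_set1.
exact: (cvg_unique _ (cvgx _ cf) (cvgx _ cg)).
Qed.

Definition convolution (K : realType) (f g : K -> K) (x : K) : K :=
  \int[@lebesgue_measure K]_y (f y * g (x - y)).

(* f_0 * f_1 * ... * f_n, associated to the left. *)
Definition convolution_fam (K : realType) (n : nat) (f : 'I_n.+1 -> K -> K)
    : K -> K :=
  foldl (@convolution K) (f ord0) [seq f (lift ord0 i) | i : 'I_n].

(* Main.v *)
(* In characteristic p the Frobenius power of the box ideal is the box ideal of
   the Frobenius powers, and the tensor product modulo a box ideal has a graded
   basis made of tensors of graded bases of the factors. Hence the length
   function of the tensor product is the iterated discrete convolution of the
   length functions of the factors. Rescaled by q, each factor converges
   uniformly and vanishes beyond a fixed multiple of q, so the discrete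
   convolutions are Riemann sums that converge uniformly to the convolution of
   the densities.

   The normalising exponent requires that Krull dimensions add up. Both
   inequalities come from comparing chains of primes with the growth of
   sum_(j <= m) dim G_j: a chain of primes of length d forces growth at least
   of order m^d, and, by Noetherian induction on homogeneous ideals, the absence
   of a chain of length d + 1 forces growth at most of order m^d. Growth orders
   visibly add up under tensor products. *)
Require Import Defs.
From HB Require Import structures.
From mathcomp Require Import all_boot all_order all_algebra.
From mathcomp Require Import all_classical all_reals all_analysis.
From mathcomp Require Import zify ring lra.
Import Order.TTheory GRing.Theory Num.Theory.
Import numFieldNormedType.Exports.

Set Implicit Arguments.
Unset Strict Implicit.
Unset Printing Implicit Defensive.
Local Open Scope classical_set_scope.
Local Open Scope ring_scope.

(** * Linear algebra modulo a subspace *)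

(** The tensor product is known only through its universal property, so both halves of each
    dimension count are extracted from it: uniqueness shows that pure tensors span, existence
    supplies functionals that detect independence. No quotient is formed: lengths are dimensions
    modulo a subspace [W], and bases are families in the ambient algebra. For Krull dimensions only
    orders of growth up to constants matter, so Hilbert polynomials are avoided. Primes in a chain
    need not be homogeneous, hence the lower bound lives on the filtration by degree at most m,
    while the upper bound is an induction over homogeneous ideals. Each binary convolution costs a
    factor 1/q, the mesh of the Riemann sum; n of them account for the gap between (sum of d_i) - 1
    and the sum of the d_i - 1 over the n + 1 factors. The induction over the factors carries
    vanishing at every finite level and not only in the limit; it yields the existence of the
    density of the tensor product together with its value. *)

Section LinearAlgebra.
Variables (k : fieldType) (V : lmodType k).
Implicit Types (U W : set V).

Lemma submodP W : submod_closed [in W] <->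
  W 0 /\ forall (a : k) u v, W u -> W v -> W (a *: u + v).
Proof.
split=> [[W0 WD]|[W0 WD]]; split.
- by move: W0; rewrite inE.
- by move=> a u v Wu Wv; move: (WD a u v); rewrite !inE; apply.
- by rewrite inE.
- by move=> a u v; rewrite !inE; apply: WD.
Qed.

Section Closure.
Variables (W : set V) (sW : submod_closed [in W]).

Lemma submod0 : W 0. Proof. by case/submodP: sW. Qed.
Lemma submodZD a u v : W u -> W v -> W (a *: u + v).
Proof. by case/submodP: sW => _; apply. Qed.
Lemma submodZ a u : W u -> W (a *: u).
Proof. by move=> Wu; rewrite -[_ *: _]addr0; apply: submodZD => //; exact: submod0. Qed.
Lemma submodD u v : W u -> W v -> W (u + v).
Proof. by move=> Wu Wv; rewrite -[u]scale1r; apply: submodZD. Qed.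
Lemma submodN u : W u -> W (- u).
Proof. by move=> Wu; rewrite -scaleN1r; apply: submodZ. Qed.
Lemma submodB u v : W u -> W v -> W (u - v).
Proof. by move=> Wu Wv; apply: submodD => //; apply: submodN. Qed.
Lemma submod_sum (J : Type) (r : seq J) (P : pred J) (F : J -> V) :
  (forall i, P i -> W (F i)) -> W (\sum_(i <- r | P i) F i).
Proof.
by move=> WF; apply: (big_ind W) => //; [exact: submod0|exact: submodD].
Qed.
Lemma submod_comb (J : Type) (r : seq J) (P : pred J) (c : J -> k) (F : J -> V) :
  (forall i, P i -> W (F i)) -> W (\sum_(i <- r | P i) c i *: F i).
Proof. by move=> WF; apply: submod_sum => i Pi; apply/submodZ/WF. Qed.
End Closure.

Lemma submod_zero : submod_closed [in [set 0 : V]].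
Proof. by apply/submodP; split=> // a u v -> ->; rewrite scaler0 addr0. Qed.

Lemma lspan_submod (S : set V) : submod_closed [in lspan S].
Proof.
apply/submodP; split.
  by move=> W [sW _]; exact: submod0.
move=> a u v Su Sv W [sW SW]; apply: submodZD => //; [exact: Su|exact: Sv].
Qed.

Lemma sub_lspan (S : set V) : S `<=` lspan S.
Proof. by move=> u Su W [_]; apply. Qed.

Lemma lspan_min (S W : set V) : submod_closed [in W] -> S `<=` W -> lspan S `<=` W.
Proof. by move=> sW SW u; apply. Qed.

(** Families are indexed by arbitrary finite types, since later ones are indexed by sums, dependent
    pairs and tuples. *)
Definition indep_mod W (I : finType) (e : I -> V) :=
  forall c : I -> k, W (\sum_i c i *: e i) -> forall i, c i = 0.

Definition span_mod U W (I : finType) (e : I -> V) :=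
  (forall i, U (e i)) /\
  forall u, U u -> exists c : I -> k, W (u - \sum_i c i *: e i).

(** Steinitz by rank: a row vector killed by the matrix of coordinates of [e] along [f] gives a
    combination of [e] lying in [W], so the rows are independent. *)
Lemma indep_span_leq U W (I J : finType) (e : I -> V) (f : J -> V) :
  submod_closed [in W] -> (forall i, U (e i)) ->
  indep_mod W e -> span_mod U W f -> (#|I| <= #|J|)%N.
Proof.
move=> sW Ue ie [_ sf].
have /choice[A HA] : forall i, exists c : J -> k, W (e i - \sum_j c j *: f j).
  by move=> i; apply: sf.
pose M := \matrix_(a < #|I|, b < #|J|) A (enum_val a) (enum_val b).
suff : row_free M by rewrite /row_free => /eqP <-; exact: rank_leq_col.
apply/inj_row_free => v vM0; apply/rowP => a; rewrite mxE.
pose c (i : I) := v ord0 (enum_rank i).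
suff c0 : forall i, c i = 0 by rewrite -[a]enum_valK; apply: c0.
apply: ie.
have -> : \sum_i c i *: e i = \sum_i c i *: (e i - \sum_j A i j *: f j).
  rewrite [RHS](eq_bigr (fun i => c i *: e i - c i *: \sum_j A i j *: f j)); last first.
    by move=> i _; rewrite scalerBr.
  rewrite sumrB (_ : \sum_i c i *: (\sum_j _) = 0) ?subr0 //.
  rewrite (eq_bigr (fun i => \sum_j (c i * A i j) *: f j)); last first.
    by move=> i _; rewrite scaler_sumr; apply: eq_bigr => j _; rewrite scalerA.
  rewrite exchange_big /= big1 // => j _; rewrite -scaler_suml.
  rewrite (_ : \sum_i _ = 0) ?scale0r //.
  move/rowP/(_ (enum_rank j)): vM0; rewrite !mxE => vE; rewrite -[RHS]vE [LHS]big_enum_val.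
  by apply: eq_bigr => b _; rewrite mxE enum_rankK /c enum_valK.
by apply: submod_comb => // i _; apply: HA.
Qed.

Lemma basis_modP U W n (e : 'I_n -> V) :
  is_basis_mod U W e <-> span_mod U W e /\ indep_mod W e.
Proof. by split=> [[]|[[]]]. Qed.

Lemma dim_modE U W n (e : 'I_n -> V) :
  submod_closed [in W] -> is_basis_mod U W e -> dim_mod U W = n.
Proof.
move=> sW be; rewrite /dim_mod; case: xgetP => [m _ [f bf]|/(_ n)]; last by case; exists e.
have [se ie] := (basis_modP _ _ _).1 be; have [sf jf] := (basis_modP _ _ _).1 bf.
apply/eqP; rewrite eqn_leq -[m in (m <= _)%N]card_ord -[n in (_ <= n)%N]card_ord.
rewrite (indep_span_leq sW sf.1 jf se) /=.
by have := indep_span_leq sW se.1 ie sf; rewrite !card_ord.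
Qed.

Lemma basis_mod_set U W (F : finType) (X : {set F}) (e : F -> V) :
  (forall f, f \in X -> U (e f)) ->
  (forall u, U u -> exists c : F -> k, W (u - \sum_(f in X) c f *: e f)) ->
  (forall c : F -> k, W (\sum_(f in X) c f *: e f) -> forall f, f \in X -> c f = 0) ->
  is_basis_mod U W (fun i : 'I_#|X| => e (enum_val i)).
Proof.
move=> Ue se ie; split.
- by move=> i; apply/Ue/enum_valP.
- move=> u /se[c Wc]; exists (c \o enum_val).
  by rewrite -(big_enum_val (fun f => c f *: e f)).
- move=> c Wc i.
  have [x0 Xx0] : exists x, x \in X by exists (enum_val i); exact: enum_valP.
  pose d f := c (enum_rank_in Xx0 f).
  have := ie d; rewrite (big_enum_val (fun f => d f *: e f)) /=.
  under eq_bigr do rewrite /d enum_valK_in.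
  by move=> /(_ Wc _ (enum_valP i)); rewrite /d enum_valK_in.
Qed.

Lemma span_mod_basis U W (I : finType) (e : I -> V) :
  submod_closed [in W] -> span_mod U W e ->
  exists n (b : 'I_n -> V), is_basis_mod U W b /\ (n <= #|I|)%N.
Proof.
move=> sW [Ue se].
pose P (X : {set I}) := `[< forall u, U u -> exists c : I -> k,
  W (u - \sum_(i in X) c i *: e i) >].
have PT : P [set: I]%SET.
  by apply/asboolP => u /se[c Wc]; exists c; under eq_bigl do rewrite finset.in_setT.
have [X /minsetP[PX minX] _] := minset_exists PT.
exists #|X|, (fun i => e (enum_val i)); split; last by rewrite max_card.
apply: basis_mod_set => //; first exact/asboolP.
move=> c Wc i Xi; apply/eqP/negP => /negP ci0.
suff /minX/(_ (subD1set _ _)) XE : P (X :\ i) by move: Xi; rewrite -XE !inE eqxx.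
apply/asboolP => u /(asboolP _ PX)[d Wd].
(* The relation is solved for [e i] and substituted, which makes the coefficient at [i] vanish. *)
exists (fun j => d j - d i / c i * c j).
suff -> : u - \sum_(j in X :\ i) (d j - d i / c i * c j) *: e j =
  (u - \sum_(j in X) d j *: e j) + (d i / c i) *: \sum_(j in X) c j *: e j.
  by apply: submodD => //; apply: submodZ.
rewrite scaler_sumr -addrA; congr (_ + _).
rewrite (big_setD1 i Xi) [in RHS](big_setD1 i Xi) /= scalerA divfK //.
rewrite opprD addrACA addNr add0r -sumrN -sumrN -big_split /=.
apply: eq_bigr => j _; rewrite scalerBl opprB scalerA addrC //.
Qed.

(** [dim_mod] defaults to 0 when there is no finite basis, so lower bounds on it need this as a
    hypothesis. *)
Definition fin_mod U W := exists n (b : 'I_n -> V), is_basis_mod U W b.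

Lemma fin_modP U W : fin_mod U W -> exists b : 'I_(dim_mod U W) -> V, is_basis_mod U W b.
Proof.
move=> [n [b bb]]; rewrite /dim_mod.
by case: xgetP => [m _|/(_ n)] //; case; exists b.
Qed.

Lemma span_mod_fin U W (I : finType) (e : I -> V) :
  submod_closed [in W] -> span_mod U W e -> fin_mod U W.
Proof. by move=> sW /(span_mod_basis sW)[n [b [bb _]]]; exists n, b. Qed.

Lemma dim_mod_leq U W (I : finType) (e : I -> V) :
  submod_closed [in W] -> span_mod U W e -> (dim_mod U W <= #|I|)%N.
Proof.
by move=> sW /(span_mod_basis sW)[n [b [bb nI]]]; rewrite (dim_modE sW bb).
Qed.

Lemma dim_mod_geq U W (I : finType) (e : I -> V) :
  submod_closed [in W] -> fin_mod U W -> (forall i, U (e i)) ->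
  indep_mod W e -> (#|I| <= dim_mod U W)%N.
Proof.
move=> sW /fin_modP[b /basis_modP[sb _]] Ue ie.
by have := indep_span_leq sW Ue ie sb; rewrite card_ord.
Qed.

Lemma dim_mod_sub U W W' : submod_closed [in W] -> submod_closed [in W'] ->
  fin_mod U W -> W `<=` W' -> fin_mod U W' /\ (dim_mod U W' <= dim_mod U W)%N.
Proof.
move=> sW sW' /fin_modP[b /basis_modP[[Ub sb] _]] WW'.
have sb' : span_mod U W' b.
  by split=> // u /sb[c /WW' Wc]; exists c.
split; first exact: span_mod_fin sb'.
by have := dim_mod_leq sW' sb'; rewrite card_ord.
Qed.

Lemma scaleD_sub_comb (J : Type) (r : seq J) (P : pred J) (e : J -> V) (x : k) u v
    (c d : J -> k) :
  x *: u + v - \sum_(i <- r | P i) (x * c i + d i) *: e i =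
  x *: (u - \sum_(i <- r | P i) c i *: e i) + (v - \sum_(i <- r | P i) d i *: e i).
Proof.
rewrite scalerBr scaler_sumr addrACA -opprD -big_split /=.
by congr (_ - _); apply: eq_bigr => i _; rewrite scalerDl scalerA.
Qed.

(** Lets a spanning property be checked on generators only, through [lspan_min]. *)
Lemma comb_mod_submod W (J : Type) (r : seq J) (P : pred J) (e : J -> V) :
  submod_closed [in W] ->
  submod_closed [in [set u | exists c : J -> k, W (u - \sum_(i <- r | P i) c i *: e i)]].
Proof.
move=> sW; apply/submodP; split.
  exists (fun=> 0); rewrite big1 ?subrr => [|i _]; last exact: scale0r.
  exact: (submod0 sW).
move=> x u v [c Wc] [d Wd]; exists (fun i => x * c i + d i).
by rewrite scaleD_sub_comb; apply: (submodZD sW).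
Qed.

(** Indexing by [nat] keeps the type of the family independent of the degree, so that bases for all
    degrees can be chosen at once. *)
Lemma fin_mod_nat_basis U W : fin_mod U W ->
  exists b : nat -> V, is_basis_mod U W (fun i : 'I_(dim_mod U W) => b i).
Proof.
move=> /fin_modP[b bb]; exists (fun i => if insub i is Some i' then b i' else 0).
have -> // : (fun i : 'I_(dim_mod U W) => if insub (i : nat) is Some i' then b i' else 0) = b.
by apply/funext => i; rewrite valK.
Qed.

End LinearAlgebra.

(** * Ideals and graded algebras *)

Section Ideals.
Variable A : comNzRingType.
Implicit Types (I J : set A) (a b : A).

Lemma ideal0 I : is_ideal I -> I 0. Proof. by case. Qed.
Lemma idealD I a b : is_ideal I -> I a -> I b -> I (a + b).
Proof. by case=> _ + _; apply. Qed.
Lemma idealM I a b : is_ideal I -> I b -> I (a * b).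
Proof. by case=> _ _; apply. Qed.
Lemma ideal_mulr I a b : is_ideal I -> I b -> I (b * a).
Proof. by move=> iI Ib; rewrite mulrC; apply: idealM. Qed.
Lemma idealN I a : is_ideal I -> I a -> I (- a).
Proof. by move=> iI Ia; rewrite -mulN1r; apply: idealM. Qed.
Lemma idealB I a b : is_ideal I -> I a -> I b -> I (a - b).
Proof. by move=> iI Ia Ib; apply: idealD => //; apply: idealN. Qed.
Lemma ideal_sum I (X : Type) (r : seq X) (P : pred X) (F : X -> A) :
  is_ideal I -> (forall i, P i -> I (F i)) -> I (\sum_(i <- r | P i) F i).
Proof.
by move=> iI IF; apply: (big_ind I) => // [|a b]; [exact: ideal0|exact: idealD].
Qed.

Lemma ideal_gen_ideal (S : set A) : is_ideal (ideal_gen S).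
Proof.
split=> [J [iJ _]|a b Sa Sb J [iJ SJ]|a b Sb J [iJ SJ]]; first exact: ideal0.
- by apply: idealD; rewrite //; [apply: Sa|apply: Sb].
- by apply: idealM => //; apply: Sb.
Qed.

Lemma sub_ideal_gen (S : set A) : S `<=` ideal_gen S.
Proof. by move=> a Sa J [_]; apply. Qed.

Lemma ideal_gen_min (S I : set A) : is_ideal I -> S `<=` I -> ideal_gen S `<=` I.
Proof. by move=> iI SI a; apply. Qed.

Definition ideal_add I a : set A := [set u | exists2 v, I v & exists b, u = v + a * b].

Lemma ideal_add_ideal I a : is_ideal I -> is_ideal (ideal_add I a).
Proof.
move=> iI; split.
- by exists 0; [exact: ideal0|exists 0; rewrite mulr0 addr0].
- move=> _ _ [v Iv [b ->]] [v' Iv' [b' ->]].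
  by exists (v + v'); [exact: idealD|exists (b + b'); rewrite mulrDr addrACA].
- move=> c _ [v Iv [b ->]]; exists (c * v); first exact: idealM.
  by exists (c * b); rewrite mulrDr mulrCA.
Qed.

Lemma sub_ideal_add I a : I `<=` ideal_add I a.
Proof. by move=> v Iv; exists v => //; exists 0; rewrite mulr0 addr0. Qed.

Lemma mem_ideal_add I a : is_ideal I -> ideal_add I a a.
Proof. by move=> iI; exists 0; [exact: ideal0|exists 1; rewrite mulr1 add0r]. Qed.

Definition ideal_quo I a : set A := [set b | I (a * b)].

Lemma ideal_quo_ideal I a : is_ideal I -> is_ideal (ideal_quo I a).
Proof.
move=> iI; split; first by rewrite /ideal_quo /= mulr0; exact: ideal0.
- by move=> b c Ib Ic; rewrite /ideal_quo /= mulrDr; exact: idealD.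
- by move=> b c Ic; rewrite /ideal_quo /= mulrCA; exact: idealM.
Qed.

Lemma sub_ideal_quo I a : is_ideal I -> I `<=` ideal_quo I a.
Proof. by move=> iI b Ib; apply: idealM. Qed.

Lemma is_primeP I : is_prime I <->
  [/\ is_ideal I, ~ I 1 & forall a b, I (a * b) -> I a \/ I b].
Proof.
split=> [[[I0 I1 ID] IM]|[iI I1 IM]].
  have I0' : I 0 by move: I0; rewrite inE.
  have ID' a b c : I b -> I c -> I (a * b + c).
    by move=> Ib Ic; move: (ID a b c); rewrite !inE; apply.
  split.
  - split => // [a b Ia Ib|a b Ib]; first by rewrite -[a]mul1r; apply: ID'.
    by rewrite -[_ * _]addr0; apply: ID'.
  - by move=> J1; move: I1; rewrite notin_setE; apply.
  - by move=> a b Iab; have := IM a b; rewrite !inE => /(_ Iab)/orP[]/asboolP; tauto.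
split; [split|].
- by rewrite inE; exact: ideal0.
- by rewrite notin_setE.
- by move=> a b c; rewrite !inE => Ib Ic; apply: idealD => //; apply: idealM.
- by move=> a b; rewrite !inE => /IM[]?; apply/orP; [left|right]; apply/asboolP.
Qed.

End Ideals.

Lemma ideal_submod (k : fieldType) (A : comAlgType k) (I : set A) :
  is_ideal I -> submod_closed [in I].
Proof.
move=> iI; apply/submodP; split; first exact: ideal0.
by move=> a u v Iu Iv; apply: idealD => //; rewrite -mulr_algl; apply: idealM.
Qed.

(** * Homogeneous components, and words in the generators *)

Definition is_hcomp (k : fieldType) (A : comAlgType k) (G : nat -> set A) (a : A)
    (Nc : nat * (nat -> A)) :=
  (forall m, G m (Nc.2 m)) /\ a = \sum_(m < Nc.1) Nc.2 m.

(** Read off from a decomposition picked by choice, with 0 beyond its length; by directness every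
    decomposition gives the same value ([hcompE]). *)
Definition hcomp (k : fieldType) (A : comAlgType k) (G : nat -> set A) (m : nat) (a : A) :=
  let Nc := xget (0%N, fun=> 0) [set Nc | is_hcomp G a Nc] in
  if (m < Nc.1)%N then Nc.2 m else 0.

(** Monomials as lists of letters: concatenation is the product and, for letters of degree 1, the
    size is the degree. *)
Definition words (A : comNzRingType) (s : seq A) : set A :=
  [set \prod_(x <- w) x | w in [set w : seq A | {subset w <= s}]].

Definition words_of (A : comNzRingType) (s : seq A) (m : nat) : set A :=
  [set \prod_(x <- w) x | w in [set w : seq A | {subset w <= s} /\ size w = m]].

Section Graded.
Variables (k : fieldType) (A : comAlgType k) (G : nat -> set A).
Hypothesis sg : standard_graded G.
Implicit Types (a b : A) (I J : set A).

Let sG m : submod_closed [in G m] := sg_submod sg m.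

(** Both decompositions are padded with zeros to a common length, where directness compares them
    term by term. *)
Lemma hcompE N (c : nat -> A) a m : (forall m, G m (c m)) ->
  a = \sum_(m < N) c m -> hcomp G m a = if (m < N)%N then c m else 0.
Proof.
move=> Gc aE; rewrite /hcomp; case: xgetP => [[N' c'] _ /= [/= Gc' aE']|]; last first.
  by move=> /(_ (N, c)); case.
pose M := maxn N N'.
pose d N c m : A := if (m < N)%N then c m else 0.
have Gd N0 (c0 : nat -> A) : (forall m, G m (c0 m)) -> forall m, G m (d N0 c0 m).
  by move=> G0 i; rewrite /d; case: ifP => // _; exact: (submod0 (sG i)).
have sumd N0 (c0 : nat -> A) : (N0 <= M)%N -> \sum_(i < N0) c0 i = \sum_(i < M) d N0 c0 i :> A.
  move=> N0M; rewrite (big_ord_widen M (fun i => c0 i) N0M) big_mkcond /=.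
  by apply: eq_bigr.
case: (ltnP m M) => mM.
  apply: (subr0_eq (@sg_direct _ _ _ sg M (fun i => d N' c' i - d N c i) _ _ m mM)).
    by move=> i; apply: (submodB (sG i)); exact: Gd.
  by rewrite sumrB -!sumd ?leq_maxl ?leq_maxr // -aE -aE' subrr.
by move: mM; rewrite geq_max !ltnNge => /andP[-> ->].
Qed.

Lemma hcompG m a : G m (hcomp G m a).
Proof.
have [N [c [Gc aE]]] := sg_span sg a.
by rewrite (hcompE m Gc aE); case: ifP => // _; exact: (submod0 (sG m)).
Qed.

Lemma hcomp_sum a : exists N, forall N', (N <= N')%N -> a = \sum_(m < N') hcomp G m a.
Proof.
have [N [c [Gc aE]]] := sg_span sg a; exists N => N' NN'.
under eq_bigr do rewrite (hcompE _ Gc aE).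
by rewrite [LHS]aE (big_ord_widen N' (fun i => c i) NN') big_mkcond.
Qed.

Lemma hcomp_id m m' a : G m a -> hcomp G m' a = if m' == m then a else 0.
Proof.
move=> Ga; rewrite (@hcompE m.+1 (fun i => if i == m then a else 0)).
- by rewrite ltnS; case: (ltngtP m' m).
- by move=> i; case: eqP => [->//|_]; exact: (submod0 (sG i)).
- by rewrite big_ord_recr /= eqxx big1 ?add0r // => i _; rewrite ltn_eqF.
Qed.

Lemma hcomp_linear m : linear (hcomp G m).
Proof.
move=> x a b; have [N aE] := hcomp_sum a; have [N' bE] := hcomp_sum b.
pose M := maxn m.+1 (maxn N N').
rewrite (@hcompE M (fun i => x *: hcomp G i a + hcomp G i b)) /=.
- by rewrite leq_maxl.
- by move=> i; apply: submodZD => //; exact: hcompG.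
- rewrite big_split /= -scaler_sumr -aE -?bE // /M; lia.
Qed.

HB.instance Definition _ m := GRing.isLinear.Build k A A *:%R (hcomp G m) (hcomp_linear m).

Lemma hcompMl d m a b : G d a ->
  hcomp G m (a * b) = if (d <= m)%N then a * hcomp G (m - d) b else 0.
Proof.
move=> Ga; have [N bE] := hcomp_sum b.
have bM := bE (maxn N m.+1) (leq_maxl _ _).
rewrite (@hcompE (d + maxn N m.+1) (fun i => if (d <= i)%N then a * hcomp G (i - d) b else 0)).
- by rewrite ltn_addl // leq_maxr.
- move=> i; case: leqP => di; last exact: (submod0 (sG i)).
  by rewrite -{1}(subnKC di); apply: sg_mul => //; apply: hcompG.
- rewrite big_split_ord /= big1 ?add0r => [|i _]; last by rewrite leqNgt ltn_ord.
  rewrite [in LHS]bM mulr_sumr; apply: eq_bigr => i _.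
  by rewrite leq_addr addKn.
Qed.

Lemma hcompM m a b :
  hcomp G m (a * b) = \sum_(i < m.+1) hcomp G i a * hcomp G (m - i) b.
Proof.
have [N aE] := hcomp_sum a.
rewrite {1}(aE (maxn N m.+1) (leq_maxl _ _)) mulr_suml linear_sum /=.
rewrite (big_ord_widen (maxn N m.+1) (fun i => hcomp G i a * hcomp G (m - i) b)) ?leq_maxr//.
rewrite [RHS]big_mkcond; apply: eq_bigr => i _.
by rewrite (hcompMl _ _ (hcompG i a)) ltnS.
Qed.

Lemma homogeneousP I : homogeneous_ideal G I <->
  is_ideal I /\ forall a m, I a -> I (hcomp G m a).
Proof.
split=> -[iI hI]; split=> //.
  move=> a m /hI[N [c [GIc aE]]]; rewrite (hcompE _ _ aE) => [|i]; last by case: (GIc i).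
  by case: ifP => // _; [case: (GIc m)|exact: ideal0].
move=> a Ia; have [N aE] := hcomp_sum a; exists N, (hcomp G ^~ a); split; last exact: aE.
by move=> m; split; [exact: hcompG|exact: hI].
Qed.

Lemma words_span s : [set` s] `<=` G 1%N ->
  smallest (fun B : set A => subalg_closed [in B]) [set` s] = [set: A] ->
  forall a, lspan (words s) a.
Proof.
move=> sG1 sT a; have : [set: A] a by [].
rewrite -sT; apply; split; last first.
  move=> x /= xs; apply: sub_lspan; exists [:: x]; last by rewrite big_seq1.
  by move=> y; rewrite inE => /eqP->.
have sW := lspan_submod (words s); split.
- by rewrite inE; apply: sub_lspan; exists [::] => //; rewrite big_nil.
- by move=> x u v; rewrite !inE; apply: (submodZD sW).
- move=> u v; rewrite !inE => Wu Wv.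
  suff : lspan (words s) `<=` [set u | lspan (words s) (u * v)] by apply.
  apply: lspan_min.
    apply/submodP; split=> [|x b c Wb Wc] /=; first by rewrite mul0r; exact: (submod0 sW).
    by rewrite mulrDl -scalerAl; apply: (submodZD sW).
  move=> _ [w ws <-] /=.
  suff : lspan (words s) `<=` [set v | lspan (words s) ((\prod_(x <- w) x) * v)] by apply.
  apply: lspan_min.
    apply/submodP; split=> [|x b c Wb Wc] /=; first by rewrite mulr0; exact: (submod0 sW).
    by rewrite mulrDr -scalerAr; apply: (submodZD sW).
  move=> _ [w' ws' <-] /=; apply: sub_lspan; exists (w ++ w'); last by rewrite big_cat.
  by move=> x; rewrite mem_cat => /orP[/ws|/ws'].
Qed.

Lemma word_G (s w : seq A) : [set` s] `<=` G 1%N -> {subset w <= s} ->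
  G (size w) (\prod_(x <- w) x).
Proof.
move=> sG1; elim: w => [|x w IHw] ws.
  rewrite big_nil (sg_deg0 sg); exists 1 => //; exact: scale1r.
rewrite big_cons /= -add1n; apply: sg_mul => //.
  by apply: sG1; apply: ws; rewrite mem_head.
by apply: IHw => y yw; apply: ws; rewrite inE yw orbT.
Qed.

(** Words span everything, and projecting to degree [m] kills those of any other length. *)
Lemma sg_words : exists s : seq A, [set` s] `<=` G 1%N /\
  forall m, G m `<=` lspan (words_of s m).
Proof.
have [s [s1 sT]] := sg_gen sg; exists s; split=> // m a Ga.
have -> : a = hcomp G m a by rewrite (hcomp_id _ Ga) eqxx.
suff : lspan (words s) `<=` [set a | lspan (words_of s m) (hcomp G m a)].
  by apply; apply: words_span.
have sW := lspan_submod (words_of s m); apply: lspan_min.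
  apply/submodP; split=> [|x b c Wb Wc] /=; first by rewrite linear0; exact: (submod0 sW).
  by rewrite linearP; apply: (submodZD sW).
move=> _ [w ws <-] /=; rewrite (hcomp_id _ (word_G s1 ws)).
case: eqP => [mE|_]; last exact: (submod0 sW).
by apply: sub_lspan; exists w.
Qed.

(** There are finitely many words of length [m]: they are the tuples over the finite type of
    generators. *)
Lemma fin_mod_graded m I : submod_closed [in I] -> fin_mod (G m) I.
Proof.
move=> sI; have [s [s1 sm]] := sg_words.
pose e (t : m.-tuple (seq_sub s)) := \prod_(i <- t) ssval i.
apply: (span_mod_fin (e := e) sI); split.
  move=> t; rewrite /e -[X in G X](size_tuple t) -(size_map (@ssval _ s)).
  rewrite -(big_map (@ssval _ s) xpredT id).
  by apply: (word_G s1) => _ /mapP[i _ ->]; exact: ssvalP.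
move=> u /sm; suff : lspan (words_of s m) `<=` [set u | exists c, I (u - \sum_i c i *: e i)] by apply.
apply: lspan_min; first exact: comb_mod_submod.
move=> _ [w [ws wm] <-] /=.
(* The word is lifted letter by letter to the finite type [seq_sub s] without losing any letter. *)
have wE : [seq val i | i <- pmap (insub : A -> option (seq_sub s)) w] = w.
  rewrite (pmap_filter (insubK _)); apply/all_filterP/allP => x xw.
  by rewrite /= isSome_insub ws.
have tm : size (pmap (insub : A -> option (seq_sub s)) w) == m.
  by rewrite -(size_map val) wE wm.
pose t := Tuple tm.
exists (fun t' => (t' == t)%:R); rewrite (bigD1 t) //= eqxx scale1r [X in e t + X]big1.
  rewrite addr0 /e -{1}wE big_map subrr; exact: (submod0 sI).
by move=> t' /negbTE->; rewrite scale0r.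
Qed.

End Graded.

(** * Noetherian rings *)

Section Noetherian.

Lemma noetherian_chain (A : comNzRingType) (L : nat -> set A) : noetherian A ->
  (forall n, is_ideal (L n)) -> (forall n, L n `<=` L n.+1) ->
  exists N, forall n, L n `<=` L N.
Proof.
move=> nA iL LS.
have Lmono i j : (i <= j)%N -> L i `<=` L j.
  move=> ij; rewrite -(subnKC ij); elim: (j - i)%N => [|d IH]; first by rewrite addn0.
  by rewrite addnS => a /IH; exact: LS.
have iU : is_ideal (\bigcup_n L n).
  split; first by exists 0%N => //; exact: ideal0.
    move=> a b [i _ La] [j _ Lb]; exists (maxn i j) => //.
    by apply: idealD => //; [apply: Lmono La|apply: Lmono Lb]; rewrite ?leq_maxl ?leq_maxr.
  by move=> a b [i _ Lb]; exists i => //; exact: idealM.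
have [s sU] := nA _ iU.
suff [N sN] : exists N, [set` s] `<=` L N.
  exists N => n a La; have : (\bigcup_n L n) a by exists n.
  by rewrite sU; apply: ideal_gen_min.
have : [set` s] `<=` \bigcup_n L n by rewrite sU; exact: sub_ideal_gen.
elim: s {sU} => [|x s IH] sU; first by exists 0%N.
have [N sN] : exists N, [set` s] `<=` L N.
  by apply: IH => y /= ys; apply: sU; rewrite /= inE ys orbT.
have [M _ xM] : (\bigcup_n L n) x by apply: sU; rewrite /= inE eqxx.
exists (maxn N M) => y /=; rewrite inE => /orP[/eqP->|ys].
  by apply: Lmono xM; rewrite leq_maxr.
by apply: Lmono (sN _ ys); rewrite leq_maxl.
Qed.

(** Zorn applies because the union of a nonempty chain is finitely generated, hence already equal to
    one of its members. *)
Lemma noetherian_max (A : comNzRingType) (P : set A -> Prop) : noetherian A ->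
  (forall I, P I -> is_ideal I) -> (exists I, P I) ->
  exists I, P I /\ forall J, P J -> ~ I `<` J.
Proof.
move=> nA iP [I0 PI0].
pose Q (X : set A) := X = set0 \/ P X.
have [F FQ|M [QM maxM]] := @Zorn_bigcup A Q; last first.
  exists M; case: QM => [M0|PM].
    exfalso; apply: (maxM I0); last by right.
    rewrite M0; split; [exact: sub0set|by move=> /(_ _ (ideal0 (iP _ PI0)))].
  by split=> // J PJ MJ; apply: (maxM J) => //; right.
move=> totF.
have [F0|[X0 FX0 PX0]] : (\bigcup_(X in F) X = set0) \/ exists2 X, F X & P X.
- case: (pselect (exists2 X, F X & P X)) => [|nF]; [by right|left].
  rewrite -subset0 => a [X FX Xa]; case: (FQ _ FX) => [XE|PX]; first by rewrite -XE.
  by exfalso; apply: nF; exists X.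
- by left.
right.
have FP a X : F X -> X a -> P X.
  by move=> FX Xa; case: (FQ _ FX) => // XE; move: Xa; rewrite XE.
have iU : is_ideal (\bigcup_(X in F) X).
  split; first by exists X0 => //; apply: ideal0; exact: iP.
    move=> a b [X FX Xa] [Y FY Yb].
    case: (totF _ _ FX FY) => XY.
      by exists Y => //; apply: idealD; [apply: iP; apply: FP Yb|apply: XY|].
    by exists X => //; apply: idealD; [apply: iP; apply: FP Xa| |apply: XY].
  move=> a b [X FX Xb]; exists X => //; apply: idealM => //; apply: iP; exact: FP Xb.
have [s sU] := nA _ iU.
suff [X FX sX] : exists2 X, F X & P X /\ [set` s] `<=` X.
  case: sX => PX sX.
  suff -> : \bigcup_(X in F) X = X by [].
  by rewrite eqEsubset; split; [rewrite sU; apply: ideal_gen_min => //; exact: iP|exact: bigcup_sup].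
have : [set` s] `<=` \bigcup_(X in F) X by rewrite sU; exact: sub_ideal_gen.
elim: s {sU} => [|x s IH] sU; first by exists X0.
have [X FX [PX sX]] : exists2 X, F X & P X /\ [set` s] `<=` X.
  by apply: IH => y /= ys; apply: sU; rewrite /= inE ys orbT.
have [Y FY Yx] : (\bigcup_(X in F) X) x by apply: sU; rewrite /= inE eqxx.
case: (totF _ _ FX FY) => XY.
  exists Y => //; split; first exact: FP Yx.
  by move=> y /=; rewrite inE => /orP[/eqP->//|/sX/XY].
exists X => //; split => // y /=; rewrite inE => /orP[/eqP->|/sX//].
exact: XY.
Qed.

Lemma noetherian_field (k : fieldType) : noetherian k.
Proof.
move=> I iI; case: (pselect (exists2 a, I a & a != 0)) => [[a Ia a0]|nI].
  exists [:: a]; rewrite eqEsubset; split.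
    move=> b _; rewrite -[b](mulfVK a0); apply: idealM (ideal_gen_ideal _) _.
    by apply: sub_ideal_gen; rewrite /= inE.
  by apply: ideal_gen_min => // b /=; rewrite inE => /eqP->.
exists [::]; rewrite eqEsubset; split; last exact: ideal_gen_min.
move=> a Ia; have [->|a0] := eqVneq a 0; first exact: (ideal0 (ideal_gen_ideal _)).
by exfalso; apply: nI; exists a.
Qed.

Lemma noetherian_surj (A B : comNzRingType) (h : {rmorphism A -> B}) :
  (forall b, exists a, h a = b) -> noetherian A -> noetherian B.
Proof.
move=> hs nA I iI.
have iJ : is_ideal (h @^-1` I).
  split; rewrite /preimage /=; first by rewrite rmorph0; exact: ideal0.
    by move=> a b Ia Ib; rewrite rmorphD; exact: idealD.
  by move=> a b Ib; rewrite rmorphM; exact: idealM.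
have [s sJ] := nA _ iJ; exists (map h s); rewrite eqEsubset; split; last first.
  apply: ideal_gen_min => // b /= /mapP[a sa ->].
  have : (h @^-1` I) a by rewrite sJ; exact: sub_ideal_gen.
  by [].
move=> b Ib; have [a ab] := hs b; subst b.
have : (h @^-1` I) a by [].
rewrite sJ; suff : ideal_gen [set` s] `<=` h @^-1` (ideal_gen [set` map h s]) by apply.
have iK := ideal_gen_ideal [set` map h s].
apply: ideal_gen_min; last by move=> x xs; apply: sub_ideal_gen; apply/mapP; exists x.
split; rewrite /preimage /=; first by rewrite rmorph0; exact: (ideal0 iK).
  by move=> x y Ia Ib'; rewrite rmorphD; exact: (idealD iK).
by move=> x y Ib'; rewrite rmorphM; exact: (idealM _ iK).
Qed.

(** The coefficients of degree [n] of elements of [I] of degree at most [n] form an ascending chain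
    of ideals [L n], constant from some [N] on. Lifts of generators of [L 0], ..., [L N] generate
    [I]: subtracting a suitable combination removes the leading term, and the size decreases. *)
Theorem hilbert_basis (A : comNzRingType) : noetherian A -> noetherian {poly A}.
Proof.
move=> nA I iI.
pose L n : set A := [set a | exists2 f : {poly A}, I f & (size f <= n.+1)%N /\ f`_n = a].
have iL n : is_ideal (L n).
  split.
  - by exists 0; [exact: (ideal0 iI)|rewrite size_poly0 coef0].
  - move=> a b [f If [sf fa]] [g Ig [sg gb]]; exists (f + g); first exact: idealD.
    by rewrite coefD fa gb (leq_trans (size_polyD _ _)) // geq_max sf sg.
  - move=> a b [f If [sf fb]]; exists (a%:P * f); first exact: idealM.
    by rewrite coefCM fb mul_polyC (leq_trans (size_scale_leq _ _)).
have LS n : L n `<=` L n.+1.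
  move=> a [f If [sf fa]]; exists ('X * f); first exact: idealM.
  rewrite coefXM /= fa; split => //.
  by rewrite (leq_trans (size_polyMleq _ _)) // size_polyX.
have [N LN] := noetherian_chain nA iL LS.
have /choice[S SE] : forall n, exists s : seq A, L n = ideal_gen [set` s].
  by move=> n; apply: nA.
have /choice[lft lftP] : forall na : nat * A, exists f : {poly A},
    L na.1 na.2 -> [/\ I f, (size f <= na.1.+1)%N & f`_(na.1) = na.2].
  move=> [n a]; case: (pselect (L n a)) => [[f If [sf fa]]|nL]; first by exists f.
  by exists 0.
pose gs := flatten [seq [seq lft (n, a) | a <- S n] | n <- iota 0 N.+1].
exists gs; have iJ := ideal_gen_ideal [set` gs].
have JI : ideal_gen [set` gs] `<=` I.
  apply: ideal_gen_min => // f /= /flattenP[_ /mapP[n _ ->] /mapP[a aS ->]].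
  have : L n a by rewrite SE; exact: sub_ideal_gen.
  by move=> /(lftP (n, a))[].
rewrite eqEsubset; split => //.
(* Up to degree [N], every leading coefficient is realised by a combination of the lifts without
   exceeding the size bound; the property passes from the generators of [L n] to all of it. *)
have key n a : (n <= N)%N -> L n a ->
    exists f : {poly A}, [/\ ideal_gen [set` gs] f, (size f <= n.+1)%N & f`_n = a].
  move=> nN; rewrite SE; suff : ideal_gen [set` S n] `<=` [set a | exists f : {poly A},
      [/\ ideal_gen [set` gs] f, (size f <= n.+1)%N & f`_n = a]] by apply.
  apply: ideal_gen_min.
    split.
    - by exists 0; rewrite size_poly0 coef0; split => //; exact: (ideal0 iJ).
    - move=> x y [f [If sf fa]] [g [Ig sg gb]]; exists (f + g); split; first exact: (idealD iJ).
        by rewrite (leq_trans (size_polyD _ _)) // geq_max sf sg.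
      by rewrite coefD fa gb.
    - move=> x y [f [If sf fb]]; exists (x%:P * f); split; first exact: (idealM _ iJ).
        by rewrite mul_polyC (leq_trans (size_scale_leq _ _)).
      by rewrite coefCM fb.
  move=> x /= xS; exists (lft (n, x)).
  have /(lftP (n, x))[_ sf fE] : L n x by rewrite SE; exact: sub_ideal_gen.
  split => //; apply: sub_ideal_gen; apply/flattenP.
  exists [seq lft (n, a) | a <- S n]; last exact: map_f.
  by apply/mapP; exists n => //; rewrite mem_iota.
move=> f; have [d] := ubnP (size f); elim: d f => // d IH f sfd If.
case: (posnP (size f)) => [/eqP|sf0].
  by rewrite size_poly_eq0 => /eqP->; exact: ideal0.
pose n := (size f).-1.
have sfn : size f = n.+1 by rewrite prednK.
have Lf : L n f`_n by exists f => //; rewrite sfn.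
have [g [Jg sg gE]] : exists g : {poly A}, [/\ ideal_gen [set` gs] g,
    (size g <= n.+1)%N & g`_n = f`_n].
  case: (leqP n N) => nN; first exact: key.
  (* Above [N], the coefficient is already realised in degree [N], and a power of 'X moves it to
     degree [n]. *)
  have [g [Jg sg gE]] := key N _ (leqnn N) (LN _ _ Lf).
  exists ('X^(n - N) * g); split; first exact: (idealM _ iJ).
    rewrite (leq_trans (size_polyMleq _ _)) // size_polyXn /=.
    by rewrite (leq_trans (leq_add (leqnn _) sg)) // addnS subnK // ltnW.
  by rewrite coefXnM ltnNge leq_subr /= subKn ?gE // ltnW.
rewrite -[f](subrK g); apply: (idealD iJ) => //; apply: IH; last by apply: (idealB iI) => //; exact: JI.
apply: (@leq_ltn_trans n); last by rewrite -sfn.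
apply/leq_sizeP => j; rewrite leq_eqVlt => /orP[/eqP<-|nj].
  by rewrite coefB gE subrr.
by rewrite coefB !nth_default ?subrr // ?sfn // (leq_trans sg).
Qed.

Lemma finitely_generated_noetherian (k : fieldType) (A : comAlgType k) (s : seq A) :
  smallest (fun B : set A => subalg_closed [in B]) [set` s] = [set: A] -> noetherian A.
Proof.
move=> sT.
(* [P] is an iterated polynomial ring over [k], with one variable per generator. It is known only as
   a ring, hence the separate clause saying that scalars are reached. *)
have [P nP [h [hk hs]]] : exists2 P : comNzRingType, noetherian P &
    exists h : {rmorphism P -> A}, (forall c : k, exists x, h x = c%:A) /\
      forall a, a \in s -> exists x, h x = a.
  elim: s {sT} => [|a s [P nP [h [hk hs]]]].
    exists k; first exact: noetherian_field.
    by exists (in_alg A); split => // c; exists c.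
  exists {poly P}; first exact: hilbert_basis.
  exists (horner_eval a \o map_poly h : {rmorphism {poly P} -> A}); split.
    move=> c; have [x xc] := hk c; exists x%:P.
    rewrite /= map_polyC /horner_eval hornerC; exact: xc.
  move=> b; rewrite inE => /orP[/eqP->|bs].
    by exists 'X; rewrite /= map_polyX /horner_eval hornerX.
  have [x xb] := hs b bs; exists x%:P.
  rewrite /= map_polyC /horner_eval hornerC; exact: xb.
apply: (noetherian_surj (h := h)) nP => b.
have : [set: A] b by [].
rewrite -sT; suff : smallest (fun B : set A => subalg_closed [in B]) [set` s] `<=`
  [set b | exists a, h a = b] by apply.
move=> {}b; apply; split; last by move=> a /= /hs.
split.
- by rewrite inE; exists 1; rewrite rmorph1.
- move=> c u v; rewrite !inE => -[x xu] [y yv]; have [z zc] := hk c.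
  by exists (z * x + y); rewrite rmorphD rmorphM xu yv zc mulr_algl.
- move=> u v; rewrite !inE => -[x xu] [y yv].
  by exists (x * y); rewrite rmorphM xu yv.
Qed.

Lemma sg_noetherian (k : fieldType) (A : comAlgType k) (G : nat -> set A) :
  standard_graded G -> noetherian A.
Proof. by move=> sg; have [s [_ sT]] := sg_gen sg; apply: finitely_generated_noetherian sT. Qed.

End Noetherian.

(** * Chains of primes and growth *)

Lemma big_unit (V : zmodType) (F : unit -> V) : \sum_i F i = F tt.
Proof. by rewrite (bigD1 tt) //= big1 ?addr0 // => -[]. Qed.

Section SumFamilies.
Variables (k : fieldType) (V : lmodType k) (U W : set V) (I J : finType).
Variables (e : I -> V) (f : J -> V).

Definition sum_family (x : I + J) : V := match x with inl i => e i | inr j => f j end.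

Lemma big_sum_family (c : I + J -> k) : \sum_x c x *: sum_family x =
  \sum_i c (inl i) *: e i + \sum_j c (inr j) *: f j.
Proof. by rewrite big_sumType. Qed.

Lemma dim_mod_leq_add : submod_closed [in W] ->
  (forall i, U (e i)) -> (forall j, U (f j)) ->
  (forall u, U u -> exists (c : I -> k) (d : J -> k),
    W (u - (\sum_i c i *: e i + \sum_j d j *: f j))) ->
  (dim_mod U W <= #|I| + #|J|)%N.
Proof.
move=> sW Ue Uf sef; rewrite -card_sum; apply: (dim_mod_leq (e := sum_family)) => //.
split; first by case.
move=> u /sef[c [d Wcd]]; exists (fun x => match x with inl i => c i | inr j => d j end).
by rewrite big_sum_family.
Qed.

Lemma dim_mod_geq_add : submod_closed [in W] -> fin_mod U W ->
  (forall i, U (e i)) -> (forall j, U (f j)) ->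
  (forall (c : I -> k) (d : J -> k), W (\sum_i c i *: e i + \sum_j d j *: f j) ->
    (forall i, c i = 0) /\ (forall j, d j = 0)) ->
  (#|I| + #|J| <= dim_mod U W)%N.
Proof.
move=> sW fW Ue Uf ief; rewrite -card_sum; apply: (dim_mod_geq (e := sum_family)) => //.
  by case.
move=> c; rewrite big_sum_family => /ief[c0 d0].
by case.
Qed.

End SumFamilies.

Section Growth.
Variables (k : fieldType) (A : comAlgType k) (G : nat -> set A).
Hypothesis sg : standard_graded G.
Implicit Types (a b : A) (I J P Q : set A).

(** The filtration by degree, which makes sense modulo ideals that are not homogeneous, such as the
    primes of an arbitrary chain. *)
Definition deg_leq m : set A := [set a | forall i, (m < i)%N -> hcomp G i a = 0].

Lemma deg_leqM m n a b : deg_leq m a -> deg_leq n b -> deg_leq (m + n) (a * b).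
Proof.
move=> Va Vb i mni; rewrite (hcompM sg) big1 // => j _.
case: (leqP j m) => jm; last by rewrite Va ?mul0r.
by rewrite Vb ?mulr0 //; lia.
Qed.

Lemma deg_leqS m n a : (m <= n)%N -> deg_leq m a -> deg_leq n a.
Proof. by move=> mn Va i ni; apply: Va; exact: leq_ltn_trans ni. Qed.

Lemma deg_leqG i m a : (i <= m)%N -> G i a -> deg_leq m a.
Proof. by move=> im Ga j mj; rewrite (hcomp_id sg _ Ga) gtn_eqF // (leq_ltn_trans im). Qed.

Lemma ex_deg_leq a : exists m, deg_leq m a.
Proof.
have [N aE] := hcomp_sum sg a; exists N => i Ni.
rewrite (hcompE sg i (fun m => hcompG sg m a) (aE N (leqnn N))).
by rewrite ltnNge (ltnW Ni).
Qed.

Lemma deg_leq_sum m a : deg_leq m a -> a = \sum_(i < m.+1) hcomp G i a.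
Proof.
move=> Va; have [N aE] := hcomp_sum sg a.
rewrite {1}(aE (maxn N m.+1) (leq_maxl _ _)).
rewrite (big_ord_widen (maxn N m.+1) (fun i => hcomp G i a) (leq_maxr N m.+1)).
rewrite [RHS]big_mkcond; apply: eq_bigr => i _; case: ifP => // /negbT; rewrite -leqNgt.
by move=> mi; rewrite Va.
Qed.

(** Bases of the graded pieces modulo [I] together span. For [I] not homogeneous they may become
    dependent modulo [I], so only an inequality holds. *)
Lemma deg_leq_fin m I : submod_closed [in I] ->
  fin_mod (deg_leq m) I /\
  (dim_mod (deg_leq m) I <= \sum_(j < m.+1) dim_mod (G j) I)%N.
Proof.
move=> sI.
pose h j := dim_mod (G j) I.
have /choice[b bP] : forall j, exists b : nat -> A, span_mod (G j) I (fun i : 'I_(h j) => b i).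
  move=> j; have [b /basis_modP[sb _]] := fin_mod_nat_basis (fin_mod_graded sg j sI).
  by exists b.
have sT : span_mod (deg_leq m) I (fun x : {j : 'I_m.+1 & 'I_(h j)} => b (tag x) (tagged x)).
  split=> [[j i]|u Vu] /=.
    by apply: deg_leqG ((bP j).1 i); rewrite -ltnS.
  have /choice[c cP] : forall j, exists c : nat -> k,
      I (hcomp G j u - \sum_(i < h j) c i *: b j i).
    move=> j; have [c cI] := (bP j).2 _ (hcompG sg j u).
    exists (fun i => if insub i is Some i' then c i' else 0).
    rewrite (eq_bigr (fun i => c i *: b j i)) // => i _; by rewrite valK.
  exists (fun x : {j : 'I_m.+1 & 'I_(h j)} => c (tag x) (tagged x)).
  rewrite -(sig_big_dep (fun _ => true) (fun _ _ => true) (fun (j : 'I_m.+1) (i : 'I_(h j)) => c j i *: b j i)) /=.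
  rewrite {1}(deg_leq_sum Vu) -sumrB; apply: (submod_sum sI) => j _; exact: cP.
split; first exact: span_mod_fin sT.
apply: leq_trans (dim_mod_leq sI sT) _.
by rewrite card_tagged sumnE big_map big_enum; apply: leq_sum => j _; rewrite card_ord.
Qed.

Lemma prime_dim_gt0 m P : is_prime P -> (0 < dim_mod (deg_leq m) P)%N.
Proof.
move=> /is_primeP[iP P1 PM]; have sP := ideal_submod iP.
rewrite -[X in (X <= _)%N]card_unit; apply: (dim_mod_geq (e := fun=> 1)) => //.
- by have [] := deg_leq_fin m sP.
- move=> _; apply: (@deg_leqG 0) => //; rewrite (sg_deg0 sg); exists 1 => //; exact: scale1r.
- move=> c; rewrite big_unit => Pc [].
  have [//|c0] := eqVneq (c tt) 0; exfalso; apply: P1.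
  by rewrite -[1](scalerK c0); apply: (submodZ sP).
Qed.

(* Lifts of a basis modulo Q together with a times a basis modulo P are linearly
   independent modulo P. *)
Lemma prime_dim_step m s P Q a : is_prime P -> is_prime Q -> P `<=` Q -> Q a -> ~ P a ->
  deg_leq s a -> (dim_mod (deg_leq (m + s)) Q + dim_mod (deg_leq m) P <=
                  dim_mod (deg_leq (m + s)) P)%N.
Proof.
move=> /is_primeP[iP P1 PM] /is_primeP[iQ Q1 QM] PQ Qa nPa Va.
have sP := ideal_submod iP; have sQ := ideal_submod iQ.
have [e /basis_modP[[Ve _] ie]] := fin_modP (deg_leq_fin (m + s) sQ).1.
have [f /basis_modP[[Vf _] jf]] := fin_modP (deg_leq_fin m sP).1.
have := @dim_mod_geq_add _ _ (deg_leq (m + s)) P _ _ e (fun j => f j * a) sP.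
rewrite !card_ord; apply => //.
- exact: (deg_leq_fin _ sP).1.
- by move=> j; apply: deg_leqM.
move=> c d Pcd.
have E : \sum_j d j *: (f j * a) = (\sum_j d j *: f j) * a.
  by rewrite mulr_suml; apply: eq_bigr => j _; rewrite scalerAl.
have c0 : forall i, c i = 0.
  apply: ie; rewrite -[X in Q X](addrK (\sum_j d j *: (f j * a))).
  by apply: (submodB sQ); [exact: PQ|rewrite E; exact: idealM].
split => //; apply: jf; move: Pcd; rewrite E big1 ?add0r => [|i _]; last by rewrite c0 scale0r.
by case/PM.
Qed.

(** The inequality of [prime_dim_step] is Pascal's rule: an induction on the number [t] of steps of
    the chain above [P (D - t)], then on [j], reproduces the recursion of the binomial
    coefficients. *)
Lemma chain_growth D : has_prime_chain A D -> exists2 s, (0 < s)%N &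
  forall j, ('C(j + D, D) <= \sum_(i < (s * j).+1) dim_mod (G i) [set (0 : A)%R])%N.
Proof.
move=> [P [pP PS]].
have /choice[a aP] : forall i, exists a, (i < D)%N -> P i.+1 a /\ ~ P i a.
  move=> i; case: (ltnP i D) => iD; last by exists 0.
  have [_ /existsNP[a /not_implyP[Pa nPa]]] := PS i iD; by exists a.
have /choice[r rP] : forall i, exists m, deg_leq m (a i) by move=> i; exact: ex_deg_leq.
(* [s] bounds the degrees of the witnesses of all strict inclusions; the successor makes it
   positive. *)
pose s := (\max_(i < D) r i).+1; exists s => // j.
have sP i : (i < D)%N -> deg_leq s (a i).
  move=> iD; apply: deg_leqS (rP i); rewrite /s leqW //.
  exact: (leq_bigmax (Ordinal iD)).
suff key t : (t <= D)%N -> forall j, ('C(j + t, t) <= dim_mod (deg_leq (s * j)) (P (D - t)%N))%N.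
  apply: leq_trans (key D (leqnn D) j) _.
  have i0 : is_ideal (P (D - D)%N) by case/is_primeP: (pP (D - D)%N (leq_subr _ _)).
  have [f0 le0] := deg_leq_fin (s * j) (@submod_zero _ A).
  apply: leq_trans le0; apply: (dim_mod_sub _ _ f0 _).2; [exact: submod_zero|exact: ideal_submod|].
  by move=> _ ->; exact: ideal0.
elim: t => [|t IHt] tD.
  by move=> i; rewrite addn0 bin0; apply: prime_dim_gt0; apply: pP; exact: leq_subr.
elim=> [|i IHi].
  by rewrite add0n binn; apply: prime_dim_gt0; apply: pP; exact: leq_subr.
(* One summand is bounded modulo the larger prime by the induction on [t], the other modulo the
   smaller prime, [s] degrees lower, by the induction on [i]. *)
rewrite addSn binS addnC.
have DE : (D - t = (D - t.+1).+1)%N by lia.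
have lt : (D - t.+1 < D)%N by lia.
have [Pa nPa] := aP _ lt.
have := @prime_dim_step (s * i) s (P (D - t.+1)%N) (P (D - t)%N) (a (D - t.+1)%N).
rewrite -mulnSr => step.
apply: leq_trans (step _ _ _ _ nPa (sP _ lt)).
- by apply: leq_add => //; rewrite addnS -addSn; apply: IHt; exact: ltnW.
- by apply: pP; exact: ltnW.
- by apply: pP; exact: leq_subr.
- by rewrite DE; case: (PS _ lt).
- by rewrite DE.
Qed.

(** * Homogeneous ideals and the upper bound on growth *)

Definition chain_above J d := exists P : nat -> set A,
  [/\ forall i, (i <= d)%N -> is_prime (P i), forall i, (i < d)%N -> P i `<` P i.+1
    & J `<=` P 0%N].

Lemma chain_above_sub I J d : I `<=` J -> chain_above J d -> chain_above I d.
Proof.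
move=> IJ [P [pP PS JP]]; exists P; split => //; exact: subset_trans JP.
Qed.

Lemma chain_above_ext J I d : is_prime J -> J `<` I -> chain_above I d -> chain_above J d.+1.
Proof.
move=> pJ [JI nIJ] [P [pP PS IP]].
exists (fun i => if i is i'.+1 then P i' else J); split => //.
- by case=> // i; exact: pP.
- case=> [_|i]; last exact: PS.
  by split; [exact: subset_trans IP|move=> PJ; apply: nIJ; exact: subset_trans PJ].
Qed.

Lemma ideal_add_homogeneous J d a : homogeneous_ideal G J -> G d a ->
  homogeneous_ideal G (ideal_add J a).
Proof.
move=> /(homogeneousP sg)[iJ hJ] Ga; apply/(homogeneousP sg); split.
  exact: ideal_add_ideal.
move=> _ m [v Jv [b ->]]; exists (hcomp G m v); first exact: hJ.
exists (if (d <= m)%N then hcomp G (m - d) b else 0).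
by rewrite linearD /= (hcompMl sg _ _ Ga); case: ifP; rewrite ?mulr0.
Qed.

Lemma ideal_quo_homogeneous J d a : homogeneous_ideal G J -> G d a ->
  homogeneous_ideal G (ideal_quo J a).
Proof.
move=> /(homogeneousP sg)[iJ hJ] Ga; apply/(homogeneousP sg); split.
  exact: ideal_quo_ideal.
move=> b m; rewrite /ideal_quo /= => /(hJ _ (m + d)%N).
by rewrite (hcompMl sg _ _ Ga) leq_addl addnK.
Qed.

(** This is the exact sequence 0 -> A/(J : a) -> A/J -> A/(J + (a)) -> 0, whose first map,
    multiplication by [a], raises degrees by [d]. No nonzero multiple of [a] is homogeneous of
    degree [m < d]. *)
Lemma dim_ideal_add J d m a : homogeneous_ideal G J -> G d a ->
  (dim_mod (G m) J <= dim_mod (G m) (ideal_add J a) +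
     (if (d <= m)%N then dim_mod (G (m - d)) (ideal_quo J a) else 0))%N.
Proof.
move=> hJ Ga; have [iJ hJ'] := (homogeneousP sg _).1 hJ.
have sJ := ideal_submod iJ.
have iJ1 := ideal_add_ideal a iJ; have iJ2 := ideal_quo_ideal a iJ.
have [e /basis_modP[[Ge se] _]] := fin_modP (fin_mod_graded sg m (ideal_submod iJ1)).
(* As [u] has degree [m], only the component of [b] of degree [m - d] matters. *)
have HJ u b v : G m u -> J v -> u = v + a * b ->
    J (u - (if (d <= m)%N then a * hcomp G (m - d) b else 0)).
  move=> Gu Jv uE; have -> : u = hcomp G m u by rewrite (hcomp_id sg _ Gu) eqxx.
  rewrite uE linearD /= (hcompMl sg _ _ Ga) addrK; exact: hJ'.
have [f fP] : exists f : 'I_(if (d <= m)%N then dim_mod (G (m - d)) (ideal_quo J a) else 0) -> A,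
    span_mod (if (d <= m)%N then G (m - d)%N else set0) (ideal_quo J a) f.
  case: ifP => dm; last by exists (fun=> 0); split=> // -[].
  by have [f /basis_modP[sf _]] := fin_modP (fin_mod_graded sg (m - d) (ideal_submod iJ2)); exists f.
rewrite -[X in (_ <= X + _)%N]card_ord -[X in (_ <= _ + X)%N]card_ord.
apply: (dim_mod_leq_add (e := e) (f := fun j => a * f j)) => //.
  case: (leqP d m) f fP => dm f [Gf _] j; last by case: (j).
  by rewrite -(subnKC dm); apply: sg_mul.
move=> u Gu; have [c [v Jv [b uE]]] := se u Gu.
have Gu' : G m (u - \sum_i c i *: e i).
  by apply: (submodB (sg_submod sg m)) => //; apply: (submod_comb (sg_submod sg m)).
have := HJ _ _ _ Gu' Jv uE.
case: (leqP d m) f fP => dm f [Gf sf] Jr.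
  have [c' Jc'] := sf _ (hcompG sg (m - d) b).
  exists c, c'; move: Jc'; rewrite /ideal_quo /= mulrBr => Jc'.
  have -> : \sum_j c' j *: (a * f j) = a * \sum_j c' j *: f j.
    by rewrite mulr_sumr; apply: eq_bigr => j _; rewrite scalerAr.
  rewrite opprD addrA; have := idealD iJ Jr Jc'.
  by rewrite addrA subrK.
by exists c, (fun=> 0); rewrite big_ord0 addr0; rewrite subr0 in Jr.
Qed.

(** If [a] and [b] are outside [J], let [i] and [j] be the lowest degrees whose components are
    outside [J]. In degree [i + j] of the product, every term but one lies in [J]. *)
Lemma homogeneous_prime J : homogeneous_ideal G J -> ~ J 1 ->
  (forall i j a b, G i a -> G j b -> J (a * b) -> J a \/ J b) -> is_prime J.
Proof.
move=> /(homogeneousP sg)[iJ hJ] J1 HM; apply/is_primeP; split => // a b Jab.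
apply: contrapT => /not_orP[nJa nJb].
have low u : ~ J u -> exists i, ~ J (hcomp G i u) /\ forall l, (l < i)%N -> J (hcomp G l u).
  move=> nJu; have ex : exists i, ~~ `[< J (hcomp G i u) >].
    apply: contrapT => nex; apply: nJu; have [N uE] := hcomp_sum sg u.
    rewrite (uE N (leqnn N)); apply: ideal_sum => // i _.
    by apply: contrapT => ni; apply: nex; exists i; exact/asboolPn.
  case: (ex_minnP ex) => i /asboolPn nJi mini; exists i; split => // l li.
  by apply: contrapT => /asboolPn /mini; rewrite leqNgt li.
have [i [nJi iJl]] := low a nJa; have [j [nJj jJl]] := low b nJb.
have := hJ _ (i + j)%N Jab; rewrite (hcompM sg).
have ilt : (i < (i + j).+1)%N by rewrite ltnS leq_addr.
rewrite (bigD1 (Ordinal ilt)) //= addKn => Js.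
have : J (hcomp G i a * hcomp G j b).
  rewrite -[X in J X](addrK (\sum_(l < (i + j).+1 | l != Ordinal ilt)
    hcomp G l a * hcomp G (i + j - l) b)).
  apply: idealB => //; apply: ideal_sum => // l; rewrite -val_eqE /= => li.
  case: (ltngtP l i) li => // li _; first by apply: ideal_mulr => //; exact: iJl.
  by apply: idealM => //; apply: jJl; have := ltn_ord l; lia.
by case/(HM _ _ _ _ (hcompG sg i a) (hcompG sg j b)).
Qed.

(* An ideal with no prime above it is the unit ideal, whence the value 0 at d = 0. *)
Definition growth_bound d m := if d is d'.+1 then (m.+1 ^ d')%N else 0%N.

Lemma dim_mod_eq0 m J : is_ideal J -> (forall a, G m a -> J a) -> dim_mod (G m) J = 0%N.
Proof.
move=> iJ GJ; apply/eqP; rewrite -leqn0 -(card_ord 0).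
apply: (dim_mod_leq (e := fun _ : 'I_0 => 0)); first exact: ideal_submod.
by split=> [[]//|u Gu]; exists (fun=> 0); rewrite big_ord0 subr0; exact: GJ.
Qed.

Lemma sub_graded1 J m : is_ideal J -> G 1%N `<=` J -> (0 < m)%N -> G m `<=` J.
Proof.
move=> iJ GJ m0; have [s [s1 sm]] := sg_words sg.
apply: subset_trans (sm m) _; apply: lspan_min; first exact: ideal_submod.
move=> _ [[|x w] [ws wm] <-]; first by rewrite -wm in m0.
by rewrite big_cons; apply: ideal_mulr => //; apply/GJ/s1/ws/mem_head.
Qed.

(* A maximal counterexample M is either prime, and then M + (x) with x of degree 1
   loses one step of the chain, or has ab in M with a, b homogeneous outside M,
   and then the growth splits over M + (a) and (M : a). *)
Theorem growth_upper J d : homogeneous_ideal G J -> ~ chain_above J d ->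
  exists C, forall m, (\sum_(j < m.+1) dim_mod (G j) J <= C * growth_bound d m)%N.
Proof.
move=> hJ nJ; apply: contrapT => bJ.
(* The bound [d] is quantified inside, because the prime case passes to a larger ideal with a
   smaller [d]. *)
pose bad J := homogeneous_ideal G J /\ exists d, ~ chain_above J d /\
  ~ exists C, forall m, (\sum_(j < m.+1) dim_mod (G j) J <= C * growth_bound d m)%N.
have [M [[hM [{nJ bJ}d [nM bM]]] maxM]] : exists I, bad I /\ forall J, bad J -> ~ I `<` J.
  apply: noetherian_max; first exact: sg_noetherian sg.
  - by move=> I [[]].
  - by exists J; split => //; exists d.
have good I d' : homogeneous_ideal G I -> M `<` I -> ~ chain_above I d' ->
    exists C, forall m, (\sum_(j < m.+1) dim_mod (G j) I <= C * growth_bound d' m)%N.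
  move=> hI MI nI; apply: contrapT => bI; apply: (maxM I) MI; split => //; by exists d'.
have [iM hM'] := (homogeneousP sg _).1 hM.
have [M1|nM1] := pselect (M 1).
  apply: bM; exists 0%N => m; rewrite big1 // => j _; apply: dim_mod_eq0 => // a _.
  by rewrite -[a]mulr1; exact: idealM.
have [pM|npM] := pselect (is_prime M).
  case: d nM bM => [nM _|d nM bM].
    by apply: nM; exists (fun=> M); split.
  (* If [M] contains all of degree 1, only degree 0 contributes, with dimension at most 1. *)
  have [G1M|/existsNP[x /not_implyP[Gx nMx]]] := pselect (G 1%N `<=` M).
    apply: bM; exists 1%N => m; rewrite mul1n big_ord_recl big1 => [|j _]; last first.
      by apply: dim_mod_eq0 => //; exact: sub_graded1.
    rewrite addn0; apply: (@leq_trans 1); last by rewrite /= expn_gt0.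
    rewrite -card_unit; apply: (dim_mod_leq (e := fun=> 1)); first exact: ideal_submod.
    split=> [_|u]; rewrite (sg_deg0 sg); first by exists 1 => //; exact: scale1r.
    move=> [c _ <-]; exists (fun=> c); rewrite big_unit subrr.
    exact: ideal0.
  have MI : M `<` ideal_add M x.
    split; first exact: sub_ideal_add.
    by move=> /(_ x (mem_ideal_add x iM)).
  have [C CP] := good _ d (ideal_add_homogeneous hM Gx) MI (fun ch => nM (chain_above_ext pM MI ch)).
  apply: bM; exists C => m.
  have quoE : ideal_quo M x = M.
    rewrite eqEsubset; split; last exact: sub_ideal_quo.
    by move=> b; case/is_primeP: pM => _ _ PM /PM[].
  (* Since [(M : x) = M], passing from degree [i] to [i + 1] adds at most the contribution of
     [M + (x)], and the bounds telescope. *)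
  have H i : (dim_mod (G i) M <= \sum_(j < i.+1) dim_mod (G j) (ideal_add M x))%N.
    elim: i => [|i IHi]; first by have := dim_ideal_add 0 hM Gx; rewrite big_ord1 /= addn0.
    have := dim_ideal_add i.+1 hM Gx; rewrite quoE /= subn1 /= => le.
    by apply: leq_trans le _; rewrite big_ord_recr /= addnC leq_add2r.
  (* Summing over [m + 1] degrees raises the exponent by one, which restores the step of the chain
     that was lost. *)
  apply: (@leq_trans (\sum_(j < m.+1) C * growth_bound d m)%N).
    apply: leq_sum => j _; apply: leq_trans (H j) _; apply: leq_trans (CP j) _.
    rewrite leq_mul2l; apply/orP; right; case: (d) => //= d'.
    by case: d' => [|d'] //; rewrite leq_exp2r.
  rewrite sum_nat_const card_ord mulnCA leq_mul2l; apply/orP; right.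
  by case: (d) => [|d'] /=; rewrite ?muln0 // expnS.
have [i [j [a [b [Ga Gb Mab nMa nMb]]]]] : exists i j a b,
    [/\ G i a, G j b, M (a * b), ~ M a & ~ M b].
  apply: contrapT => nex; apply: npM; apply: homogeneous_prime => // i j a b Ga Gb Mab.
  by apply: contrapT => /not_orP[nMa nMb]; apply: nex; exists i, j, a, b.
have MI1 : M `<` ideal_add M a.
  by split; [exact: sub_ideal_add|move=> /(_ a (mem_ideal_add a iM))].
have MI2 : M `<` ideal_quo M a.
  by split; [exact: sub_ideal_quo|move=> /(_ b Mab)].
have [C1 C1P] := good _ d (ideal_add_homogeneous hM Ga) MI1
  (fun ch => nM (chain_above_sub MI1.1 ch)).
have [C2 C2P] := good _ d (ideal_quo_homogeneous hM Ga) MI2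
  (fun ch => nM (chain_above_sub MI2.1 ch)).
apply: bM; exists (C1 + C2)%N => m; rewrite mulnDl.
apply: (@leq_trans (\sum_(l < m.+1) (dim_mod (G l) (ideal_add M a) +
     (if (i <= l)%N then dim_mod (G (l - i)) (ideal_quo M a) else 0)))%N).
  by apply: leq_sum => l _; apply: dim_ideal_add.
rewrite big_split; apply: leq_add; first exact: C1P.
apply: leq_trans (C2P m).
have shift N : (\sum_(l < N) (if (i <= l)%N then dim_mod (G (l - i)) (ideal_quo M a) else 0) =
    \sum_(l < N - i) dim_mod (G l) (ideal_quo M a))%N.
  elim: N => [|N IHN]; first by rewrite !big_ord0.
  rewrite big_ord_recr /= IHN; case: leqP => iN; first by rewrite subSn // big_ord_recr.
  rewrite addn0. by have -> : (N.+1 - i = N - i)%N by lia.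
rewrite shift; have le : (m.+1 - i <= m.+1)%N by exact: leq_subr.
rewrite (big_ord_widen _ (fun l => dim_mod (G l) (ideal_quo M a)) le) big_mkcond /=.
by apply: leq_sum => l _; case: ifP.
Qed.

End Growth.

(** * Tensor products *)

Section Subspace.
Variables (k : fieldType) (V : lmodType k) (W : set V).
Hypothesis sW : submod_closed [in W].

(** The closure proof is an argument, so that module structures can be attached to any closed set.
    The resulting type serves as a target of the universal property in [tens_span]. *)
Definition subspace_pred of submod_closed [in W] : {pred V} := [in W].
HB.instance Definition _ := GRing.isSubmodClosed.Build k V (subspace_pred sW) sW.

Record subspace := Subspace { subspace_val : V; _ : subspace_val \in subspace_pred sW }.
HB.instance Definition _ := [isSub for subspace_val].
HB.instance Definition _ := [Choice of subspace by <:].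
HB.instance Definition _ := [SubChoice_isSubLmodule of subspace by <:].

Lemma subspace_valP (u : subspace) : W (val u).
Proof. by have := valP u; rewrite /subspace_pred inE. Qed.

Definition to_subspace (v : V) (Wv : W v) : subspace := @Subspace v (mem_set Wv).

End Subspace.

Section Multilinear.
Variables (k : fieldType) (n : nat) (R : 'I_n -> comAlgType k).
Implicit Types (x y : forall i, R i).

Lemma dfwith_id x i : dfwith x i (x i) = x.
Proof. by apply: functional_extensionality_dep => j; case: dfwithP. Qed.

Lemma dfwith_map (R' : 'I_n -> Type) (phi : forall i, R i -> R' i) x i (a : R i) :
  (fun j => phi j (dfwith x i a j)) = dfwith (fun j => phi j (x j)) i (phi i a).
Proof.
apply: functional_extensionality_dep => j.
by case: dfwithP => [|j' ij]; rewrite ?dfwithin // dfwithout.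
Qed.

Lemma dfwith_mul x y i (a b : R i) :
  (fun j => dfwith x i a j * dfwith y i b j) = dfwith (fun j => x j * y j) i (a * b).
Proof.
apply: functional_extensionality_dep => j.
by case: dfwithP => [|j' ij]; rewrite ?dfwithin // !dfwithout.
Qed.

Lemma multilinear_prod (phi : forall i, R i -> k) :
  (forall i c u v, phi i (c *: u + v) = c * phi i u + phi i v) ->
  multilinear_map (V := k^o) (fun x => \prod_i phi i (x i)).
Proof.
move=> lphi i x c u v.
have E (a : R i) : \prod_j phi j (dfwith x i a j) = phi i a * \prod_(j | j != i) phi j (x j).
  rewrite (bigD1 i) //= dfwithin; congr (_ * _).
  by apply: eq_bigr => j ji; rewrite dfwithout // eq_sym.
by rewrite !E lphi mulrDl -mulrA.
Qed.

Lemma multilinear_comp (V : lmodType k) (g : (forall i, R i) -> V)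
    (phi : forall i, R i -> R i) :
  (forall i, linear (phi i)) -> multilinear_map g ->
  multilinear_map (fun x => g (fun i => phi i (x i))).
Proof.
move=> lphi lg i x c u v; rewrite !dfwith_map lphi; exact: lg.
Qed.

Section MultilinearMap.
Variables (V : lmodType k) (g : (forall i, R i) -> V).
Hypothesis lg : multilinear_map g.

Lemma multilinear0 x i : x i = 0 -> g x = 0.
Proof.
move=> xi0; have := @lg i x (-1) (x i) (x i).
by rewrite scaleN1r addNr dfwith_id scaleN1r addNr -xi0 dfwith_id.
Qed.

(* The slots are passed from S i to its span one at a time. *)
Lemma multilinear_lspan (W : set V) (S : forall i, set (R i)) :
  submod_closed [in W] -> (forall x, (forall i, S i (x i)) -> W (g x)) ->
  forall x, (forall i, lspan (S i) (x i)) -> W (g x).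
Proof.
move=> sW SW.
suff key m : forall x, (forall i : 'I_n, (i < m)%N -> lspan (S i) (x i)) ->
    (forall i : 'I_n, (m <= i)%N -> S i (x i)) -> W (g x).
  by move=> x Sx; apply: (key n) => // i; rewrite leqNgt ltn_ord.
elim: m => [|m IHm] x Lx Sx; first by apply: SW => i; apply: Sx.
case: (ltnP m n) => mn; last first.
  apply: IHm => i mi; first by apply: Lx; rewrite ltnS ltnW.
  by have := ltn_ord i; rewrite ltnNge (leq_trans mn).
pose i0 := Ordinal mn.
rewrite -(dfwith_id x i0); have := Lx i0 (ltnSn m).
suff : lspan (S i0) `<=` [set a | W (g (dfwith x i0 a))] by apply.
apply: lspan_min.
  apply/submodP; split=> [|c u v Wu Wv] /=.
    by rewrite (@multilinear0 _ i0) ?dfwithin //; exact: (submod0 sW).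
  by rewrite lg; apply: (submodZD sW).
move=> a Sa /=; apply: IHm => i mi.
  by rewrite dfwithout; [apply: Lx; exact: ltnW|rewrite -val_eqE /= gtn_eqF].
move: mi; rewrite leq_eqVlt => /orP[/eqP mi|mi].
  by have <- : i0 = i by [apply: val_inj]; rewrite dfwithin.
by rewrite dfwithout; [apply: Sx|rewrite -val_eqE /= ltn_eqF].
Qed.

End MultilinearMap.
End Multilinear.

(** * Pure tensors and box ideals *)

Section Tensor.
Variables (k : fieldType) (n : nat) (R : 'I_n -> comAlgType k) (T : comAlgType k).
Variables (tens : (forall i, R i) -> T).
Hypothesis tensP : is_tensor_product tens.
Implicit Types (x y : forall i, R i).

Let tens_lin : multilinear_map tens. Proof. by case: tensP. Qed.
Let tens1 : tens (fun i => 1) = 1. Proof. by case: tensP. Qed.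
Let tensM x y : tens (fun i => x i * y i) = tens x * tens y. Proof. by case: tensP. Qed.

Lemma tens_prod (X : Type) (r : seq X) (F : X -> forall i, R i) :
  tens (fun i => \prod_(a <- r) F a i) = \prod_(a <- r) tens (F a).
Proof.
elim: r => [|a r IHr].
  rewrite big_nil -tens1; congr tens.
  by apply: functional_extensionality_dep => i; rewrite big_nil.
rewrite big_cons -IHr -tensM; congr tens.
by apply: functional_extensionality_dep => i; rewrite big_cons.
Qed.

Lemma tensX x q : tens (fun i => x i ^+ q) = tens x ^+ q.
Proof.
elim: q => [|q IHq]; first by rewrite expr0.
by rewrite exprS -IHq -tensM; congr tens; apply: functional_extensionality_dep => i; rewrite exprS.
Qed.

Lemma tens_split x : tens x = \prod_i tens (dfwith (fun=> 1) i (x i)).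
Proof.
rewrite -(tens_prod (index_enum _) (fun i => dfwith (fun=> 1) i (x i))).
congr tens; apply: functional_extensionality_dep => j.
rewrite (bigD1 j) //= dfwithin big1 ?mulr1 // => i ij.
by rewrite dfwithout // eq_sym.
Qed.

(** The existence half of the universal property, applied with values in the ground field; products
    of coordinate functionals separate the tensors of basis vectors. *)
Lemma tens_functional (phi : forall i, R i -> k) :
  (forall i c u v, phi i (c *: u + v) = c * phi i u + phi i v) ->
  exists h : {linear T -> k^o}, forall x, h (tens x) = \prod_i phi i (x i).
Proof.
move=> lphi; have [_ univ _ _] := tensP.
by have [h hE _] := univ _ _ (multilinear_prod lphi); exists h.
Qed.

Lemma tens_endo (phi : forall i, R i -> R i) : (forall i, linear (phi i)) ->
  exists h : {linear T -> T}, forall x, h (tens x) = tens (fun i => phi i (x i)).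
Proof.
move=> lphi; have [_ univ _ _] := tensP.
by have [h hE _] := univ _ _ (multilinear_comp lphi tens_lin); exists h.
Qed.

(* The universal map into the span of the pure tensors, followed by the
   inclusion, is the identity by the uniqueness clause. *)
Lemma tens_span t : lspan (range tens) t.
Proof.
have [_ univ _ _] := tensP; have sW := lspan_submod (range tens).
have Wt x : lspan (range tens) (tens x) by apply: sub_lspan; exists x.
pose g x : subspace sW := to_subspace sW (Wt x).
have lg : multilinear_map g.
  by move=> i x c u v; apply: val_inj; exact: (@tens_lin i x c u v).
have [h hE _] := univ _ _ lg.
have [h0 _ h0E] := univ _ _ tens_lin.
have E1 : (val \o h : {linear T -> T}) =1 h0 by apply: h0E => x; rewrite /= hE.
have E2 : (idfun : {linear T -> T}) =1 h0 by apply: h0E.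
by have -> : t = val (h t); [rewrite -[RHS]/((val \o h) t) E1 -E2|exact: subspace_valP].
Qed.

Lemma tens_ind (W : set T) : submod_closed [in W] -> (forall x, W (tens x)) ->
  forall t, W t.
Proof.
move=> sW Wt t; suff : lspan (range tens) `<=` W by apply; exact: tens_span.
by apply: lspan_min => // _ [x _ <-].
Qed.

Section Box.
Variable J : forall i, set (R i).
Arguments J : clear implicits.

Lemma box_submod : submod_closed [in box_ideal tens J].
Proof.
have sJ i := lspan_submod [set tens x | x in [set x : forall j, R j | J i (x i)]].
apply/submodP; split.
  exists (fun=> 0); split; first by move=> i; exact: (submod0 (sJ i)).
  by rewrite big1.
move=> c u v [s [Js ->]] [s' [Js' ->]]; exists (fun i => c *: s i + s' i); split.
  by move=> i; apply: (submodZD (sJ i)); [exact: Js|exact: Js'].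
by rewrite big_split scaler_sumr.
Qed.

Lemma mem_box x i : J i (x i) -> box_ideal tens J (tens x).
Proof.
move=> Jx; exists (fun j => if j == i then tens x else 0); split.
  move=> j; case: eqP => [->|_]; first by apply: sub_lspan; exists x.
  exact: (submod0 (lspan_submod _)).
by rewrite -big_mkcond big_pred1_eq.
Qed.

Lemma box_min (W : set T) : submod_closed [in W] ->
  (forall i x, J i (x i) -> W (tens x)) -> box_ideal tens J `<=` W.
Proof.
move=> sW JW _ [s [Js ->]]; apply: (submod_sum sW) => i _.
have : slot_ideal tens (J i) `<=` W; last by apply.
by apply: lspan_min => // _ [x Jx <-]; apply: JW Jx.
Qed.

Lemma box_is_ideal : (forall i, is_ideal (J i)) -> is_ideal (box_ideal tens J).
Proof.
move=> iJ; have sW := box_submod; split; first exact: (submod0 sW).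
  by move=> a b; apply: (submodD sW).
move=> t; suff : [set t | forall b, box_ideal tens J b -> box_ideal tens J (t * b)] t by apply.
apply: tens_ind t.
  apply/submodP; split=> [b _|c u v Wu Wv b Wb]; first by rewrite mul0r; exact: (submod0 sW).
  by rewrite mulrDl -scalerAl; apply: (submodZD sW); [exact: Wu|exact: Wv].
move=> x; suff : box_ideal tens J `<=` [set b | box_ideal tens J (tens x * b)] by apply.
apply: box_min.
  apply/submodP; split=> [|c u v Wu Wv] /=; first by rewrite mulr0; exact: (submod0 sW).
  by rewrite mulrDr -scalerAr; apply: (submodZD sW).
by move=> i y Jy /=; rewrite -tensM; apply: (@mem_box _ i); exact: idealM.
Qed.

End Box.

(** Makes [tensor_dim] compute the Hilbert function of [T] itself. *)
Lemma box_zero : box_ideal tens (fun i => [set 0]) = [set 0].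
Proof.
rewrite eqEsubset; split; last by move=> _ ->; exact: (submod0 (box_submod _)).
apply: box_min; first exact: submod_zero.
by move=> i x /= xi0; exact: (multilinear0 tens_lin xi0).
Qed.

(** Both inclusions reduce to pure tensors. As [q] is a power of the characteristic, raising to the
    power [q] is additive, so the elements whose [q]-th power lies in the right-hand side form a
    subspace. Conversely, the elements of slot [i] whose tensors lie in the left-hand side, whatever
    fills the other slots, form an ideal containing the [q]-th powers of [I i]. *)
Lemma frobenius_power_box (p e : nat) (I : forall i, set (R i)) :
  p \in [pchar k] -> (forall i, is_ideal (I i)) ->
  frobenius_power (box_ideal tens I) (p ^ e) =
  box_ideal tens (fun i => frobenius_power (I i) (p ^ e)).
Proof.
move=> pk iI; set q := (p ^ e)%N.
have iF i : is_ideal (frobenius_power (I i) q) by exact: ideal_gen_ideal.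
have iB := box_is_ideal iF; have sB := ideal_submod iB.
have pT : p \in [pchar T] by exact: (rmorph_pchar (in_alg T)).
have qT : [pchar T].-nat q by rewrite pnatX pnatE ?pT //; case/andP: pk.
rewrite eqEsubset; split.
  apply: ideal_gen_min => // _ [t It <-].
  suff : box_ideal tens I `<=` [set t | box_ideal tens (fun i => frobenius_power (I i) q) (t ^+ q)].
    by apply.
  apply: box_min.
    apply/submodP; split=> [|c u v Wu Wv] /=.
      rewrite expr0n (_ : q == 0%N = false); first exact: (submod0 sB).
      by apply/negbTE; rewrite -lt0n; case/andP: qT.
    by rewrite exprDn_pchar // exprZn; apply: (submodZD sB).
  move=> i x Ix /=; rewrite -tensX; apply: (@mem_box _ _ i).
  by apply: sub_ideal_gen; exists (x i).
have iG := ideal_gen_ideal [set t ^+ q | t in box_ideal tens I].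
apply: box_min; first exact: ideal_submod.
move=> i x; rewrite -{2}(dfwith_id x i).
suff : frobenius_power (I i) q `<=`
    [set a | forall x, frobenius_power (box_ideal tens I) q (tens (dfwith x i a))].
  by move=> H Fx; exact: H.
apply: ideal_gen_min.
  split=> [y|a b Wa Wb y|a b Wb y] /=.
  - by rewrite (multilinear0 tens_lin (i := i)) ?dfwithin //; exact: (ideal0 iG).
  - have := @tens_lin i y 1 a b; rewrite !scale1r => ->.
    by apply: (idealD iG); [exact: Wa|exact: Wb].
  (* A multiplication inside slot [i] is a multiplication by the pure tensor with [a] in that slot
     and 1 elsewhere. *)
  - have -> : dfwith y i (a * b) = (fun j => dfwith (fun=> 1) i a j * dfwith y i b j).
      rewrite dfwith_mul; have -> // : (fun j => 1 * y j) = y.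
      by apply: functional_extensionality_dep => j; rewrite mul1r.
    rewrite tensM; apply: (idealM _ iG); exact: Wb.
move=> _ [b Ib <-] y.
(* The tensor splits as the one with 1 in slot [i] times the [q]-th power of the one with [b] in
   slot [i] and 1 elsewhere. *)
have -> : dfwith y i (b ^+ q) = (fun j => dfwith y i 1 j * (dfwith (fun=> 1) i b j) ^+ q).
  apply: functional_extensionality_dep => j.
  by case: dfwithP => [|j' ij]; rewrite ?dfwithin ?mul1r // !dfwithout // expr1n mulr1.
rewrite tensM tensX; apply: (idealM _ iG); apply: sub_ideal_gen.
exists (tens (dfwith (fun=> 1) i b)) => //; apply: (@mem_box _ _ i).
by rewrite dfwithin.
Qed.

End Tensor.

(** * Graded bases and the dimension of a tensor product modulo a box ideal *)

Section GradedBasis.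
Variables (k : fieldType) (A : comAlgType k) (G : nat -> set A) (J : set A).

(** [phi d l] is a coordinate functional defined on the whole algebra, not only in degree [d]; it
    kills [J] and is dual to the basis vectors of all degrees. *)
Record graded_basis (b : nat -> nat -> A) (phi : nat -> nat -> A -> k) : Prop := GradedBasis {
  gb_mem : forall d l, (l < dim_mod (G d) J)%N -> G d (b d l);
  gb_span : forall d u, G d u -> J (u - \sum_(l < dim_mod (G d) J) phi d l u *: b d l);
  gb_lin : forall d l c u v, phi d l (c *: u + v) = c * phi d l u + phi d l v;
  gb_ideal : forall d l u, J u -> phi d l u = 0;
  gb_dual : forall d l d' l', (l < dim_mod (G d) J)%N -> (l' < dim_mod (G d') J)%N ->
    phi d l (b d' l') = ((d == d') && (l == l'))%:R }.

(** Coordinates are picked by choice for the degree [d] component, with 0 out of range. Independence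
    makes them unique, so linearity, vanishing on [J] and duality each follow by exhibiting the
    expected coordinates. *)
Lemma ex_graded_basis : standard_graded G -> homogeneous_ideal G J ->
  exists b phi, graded_basis b phi.
Proof.
move=> sg hJ; have [iJ hJ'] := (homogeneousP sg _).1 hJ; have sJ := ideal_submod iJ.
pose h d := dim_mod (G d) J.
have /choice[b bP] : forall d, exists b : nat -> A, is_basis_mod (G d) J (fun l : 'I_(h d) => b l).
  by move=> d; exact: fin_mod_nat_basis (fin_mod_graded sg d sJ).
have /choice[c cP] : forall du : nat * A, exists c : nat -> k,
    (forall l, (h du.1 <= l)%N -> c l = 0) /\
    (J (hcomp G du.1 du.2 - \sum_(l < h du.1) c l *: b du.1 l)).
  move=> [d u] /=; have [_ /(_ _ (hcompG sg d u))[c Jc] _] := bP d.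
  exists (fun i => if insub i is Some i' then c i' else 0); split.
    by move=> l hl; rewrite insubF // ltnNge hl.
  by rewrite (eq_bigr (fun i => c i *: b d i)) // => i _; rewrite valK.
pose phi d l u := c (d, u) l.
have uniq d u (c' : nat -> k) : J (hcomp G d u - \sum_(l < h d) c' l *: b d l) ->
    forall l, (l < h d)%N -> phi d l u = c' l.
  move=> Jc' l lh; have [_ Jc] := cP (d, u); have [_ _ ib] := bP d.
  apply/eqP; rewrite -subr_eq0; apply/eqP.
  apply: (ib (fun l => phi d l u - c' l) _ (Ordinal lh)).
  have -> : \sum_(i < h d) (phi d i u - c' i) *: b d i =
    (hcomp G d u - \sum_(l < h d) c' l *: b d l) -
    (hcomp G d u - \sum_(l < h d) phi d l u *: b d l).
    rewrite opprB addrC addrA subrK -sumrB.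
    by apply: eq_bigr => i _; rewrite scalerBl.
  exact: (submodB sJ).
have out d l u : (h d <= l)%N -> phi d l u = 0 by move=> hl; case: (cP (d, u)) => /= H _; exact: H.
exists b, phi; split.
- by move=> d l lh; case: (bP d) => Gb _ _; exact: (Gb (Ordinal lh)).
- by move=> d u Gu; case: (cP (d, u)) => _ /=; rewrite (hcomp_id sg _ Gu) eqxx.
- move=> d l x u v; case: (ltnP l (h d)) => hl; last by rewrite !out // mulr0 addr0.
  rewrite (uniq d _ (fun l => x * phi d l u + phi d l v)) // linearP /=.
  have [_ Ju] := cP (d, u); have [_ Jv] := cP (d, v).
  rewrite scaleD_sub_comb; exact: (submodZD sJ).
- move=> d l u Ju; case: (ltnP l (h d)) => hl; last exact: out.
  rewrite (uniq d u (fun=> 0)) // big1 => [|i _]; last exact: scale0r.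
  by rewrite subr0; exact: hJ'.
- move=> d l d' l' lh lh'.
  have Gb : G d' (b d' l') by case: (bP d') => Gb _ _; exact: (Gb (Ordinal lh')).
  rewrite (uniq d _ (fun l => ((d == d') && (l == l'))%:R)) //.
  rewrite (hcomp_id sg _ Gb); case: eqP => [dd'|_] /=; last first.
    by rewrite big1 ?subr0 => [|i _]; [exact: (ideal0 iJ)|exact: scale0r].
  subst d'; rewrite (bigD1 (Ordinal lh')) //= eqxx scale1r big1 ?addr0 ?subrr.
    exact: (ideal0 iJ).
  by move=> i; rewrite -val_eqE /= => /negbTE->; rewrite scale0r.
Qed.

End GradedBasis.

Section TensorDim.
Variables (k : fieldType) (n : nat) (R : 'I_n -> comAlgType k) (T : comAlgType k).
Variables (tens : (forall i, R i) -> T) (G : forall i, nat -> set (R i)).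
Arguments G : clear implicits.
Hypothesis tensP : is_tensor_product tens.
Hypothesis sg : forall i, standard_graded (G i).
Implicit Types (x y : forall i, R i).

Let tens_lin : multilinear_map tens. Proof. by case: tensP. Qed.

Let tG := tensor_grading tens G.

(* Independence is detected by the functionals obtained from the products of the
   coordinate functionals of the factors. *)
Lemma tensor_dim (J : forall i, set (R i)) (N m : nat) :
  (forall i, homogeneous_ideal (G i) (J i)) -> (m < N)%N ->
  dim_mod (tG m) (box_ideal tens J) =
  (\sum_(e : {ffun 'I_n -> 'I_N} | \sum_i e i == m) \prod_i dim_mod (G i (e i)) (J i))%N.
Proof.
move=> hJ mN; pose h i d := dim_mod (G i d) (J i).
have exB i : exists B : (nat -> nat -> R i) * (nat -> nat -> R i -> k),
    graded_basis (G i) (J i) B.1 B.2.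
  by have [b [phi bp]] := ex_graded_basis (sg i) (hJ i); exists (b, phi).
pose b i := (sval (cid (exB i))).1; pose phi i := (sval (cid (exB i))).2.
have bP i : graded_basis (G i) (J i) (b i) (phi i) := svalP (cid (exB i)).
have sW := box_submod tens J.
(* A strict bound on all the dimensions involved, so that basis tensors are indexed by a subset of
   one fixed finite function type. *)
pose L := (\max_i \max_(d < N) h i d).+1.
have hL i (d : 'I_N) : (h i d < L)%N.
  rewrite ltnS; apply: leq_trans (leq_bigmax i); exact: (leq_bigmax d).
pose X := [set f : {ffun 'I_n -> 'I_N * 'I_L} |
  [forall i, (f i).2 < h i (f i).1]%N && (\sum_i (f i).1 == m)%N]%SET.
have XP f : f \in X -> (forall i, (f i).2 < h i (f i).1)%N /\ (\sum_i (f i).1 = m)%N.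
  by rewrite finset.inE => /andP[/forallP ? /eqP].
pose E (f : {ffun 'I_n -> 'I_N * 'I_L}) := tens (fun i => b i (f i).1 (f i).2).
have bas : is_basis_mod (tG m) (box_ideal tens J) (fun i : 'I_#|X| => E (enum_val i)).
  apply: basis_mod_set.
  - move=> f /XP[hf fm]; apply: sub_lspan.
    exists (fun i => (f i).1 : nat), (fun i => b i (f i).1 (f i).2); split => // i.
    exact: (gb_mem (bP i)).
  - move=> u; pose W := [set u | exists c : {ffun 'I_n -> 'I_N * 'I_L} -> k,
      box_ideal tens J (u - \sum_(f in X) c f *: E f)].
    suff : tG m `<=` W by apply.
    have sW' : submod_closed [in W] by exact: comb_mod_submod.
    have BW t : box_ideal tens J t -> W t.
      by move=> Bt; exists (fun=> 0); rewrite big1 ?subr0 // => i _; exact: scale0r.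
    apply: lspan_min => // _ [e [x [em Gx ->]]].
    have eN i : (e i < N)%N.
      by apply: leq_ltn_trans mN; rewrite -em (bigD1 i) //= leq_addr.
    (* Modulo the box ideal, multilinearity reduces each slot to an element of [J i], which kills
       the tensor, or to a basis vector. *)
    pose S i : set (R i) := [set v | J i v \/ exists2 l, (l < h i (e i))%N & v = b i (e i) l].
    apply: (multilinear_lspan tens_lin (S := S) sW').
      move=> y Sy; have [[i Ji]|nJ] := pselect (exists i, J i (y i)).
        by apply: BW; exact: (mem_box tens Ji).
      have /choice[l lP] : forall i, exists l, (l < h i (e i))%N /\ y i = b i (e i) l.
        by move=> i; case: (Sy i) => [Ji|[l lh yE]]; [case: nJ; exists i|exists l].
      have lL i : (l i < L)%N by apply: ltn_trans (lP i).1 (hL i (Ordinal (eN i))).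
      pose f : {ffun 'I_n -> 'I_N * 'I_L} := [ffun i => (Ordinal (eN i), Ordinal (lL i))].
      have fX : f \in X.
        rewrite finset.inE; apply/andP; split.
          by apply/forallP => i; rewrite ffunE /=; case: (lP i).
        by apply/eqP; rewrite -em; apply: eq_bigr => i _; rewrite ffunE.
      exists (fun g => (g == f)%:R); rewrite (bigD1 f) //= eqxx scale1r big1 ?addr0.
        suff -> : tens y = E f by rewrite subrr; exact: (submod0 sW).
        by congr tens; apply: functional_extensionality_dep => i; rewrite ffunE (lP i).2.
      by move=> g /andP[_ /negbTE->]; rewrite scale0r.
    move=> i; have Jr := gb_span (bP i) (Gx i).
    have sS := lspan_submod (S i).
    rewrite -[x i](subrK (\sum_(l < h i (e i)) phi i (e i) l (x i) *: b i (e i) l)).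
    apply: (submodD sS); first by apply: sub_lspan; left.
    by apply: (submod_comb sS) => l _; apply: sub_lspan; right; exists l.
  - move=> c Wc f fX; have [hf _] := XP f fX.
    have [F FE] := tens_functional tensP (phi := fun i => phi i (f i).1 (f i).2)
      (fun i => gb_lin (bP i) (f i).1 (f i).2).
    have F0 : box_ideal tens J `<=` [set t | F t = 0].
      apply: box_min.
        apply/submodP; split=> [|x u v Fu Fv] /=; first by rewrite linear0.
        by rewrite linearP Fu Fv scaler0 addr0.
      by move=> i x Jx /=; rewrite FE (bigD1 i) //= (gb_ideal (bP i)) ?mul0r.
    have := F0 _ Wc; rewrite /= linear_sum (bigD1 f) //= big1 => [|g /andP[gX gf]].
      rewrite addr0 linearZ /= FE big1 ?[_ *: _]mulr1 // => i _.
      by rewrite (gb_dual (bP i)) // !eqxx.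
    have [hg _] := XP g gX.
    have [i fgi] : exists i, f i != g i.
      apply/existsP; apply: contraNT gf; rewrite negb_exists => /forallP fg.
      by apply/eqP/ffunP => i; have := fg i; rewrite negbK => /eqP.
    rewrite linearZ /= FE (bigD1 i) //= (gb_dual (bP i)) //.
    case: andP => [[/eqP e1 /eqP e2]|_]; last by rewrite mul0r scaler0.
    case/negP: fgi; rewrite -pair_eqE /=; apply/andP; split; apply/eqP; exact: val_inj.
rewrite (dim_modE sW bas) -sum1_card.
(* Basis tensors are grouped by their degree vector [e]; each group is a product over the slots,
   counted by [card_family]. *)
rewrite (partition_big (fun f : {ffun 'I_n -> 'I_N * 'I_L} => [ffun i => (f i).1]) (fun e : {ffun 'I_n -> 'I_N} => \sum_i e i == m)%N) /=; last first.
  by move=> f /XP[_ <-]; apply/eqP/eq_bigr => i _; rewrite ffunE.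
apply: eq_bigr => e /eqP em.
rewrite (eq_bigl (mem (family (fun i => [pred p : 'I_N * 'I_L | (p.1 == e i) && (p.2 < h i (e i))%N])))).
  rewrite sum1_card card_family foldrE big_image /=; apply: eq_bigr => i _.
  rewrite -sum1_card -(pair_big_dep (pred1 (e i)) (fun _ (j : 'I_L) => j < h i (e i))%N (fun _ _ => 1%N)).
  by rewrite big_pred1_eq big_ord_narrow ?sum1_card ?card_ord // ltnW.
move=> f /=; apply/andP/familyP => [[/XP[hf _] /eqP<-] i|Ff].
  by rewrite inE !ffunE eqxx hf.
have fe i : (f i).1 = e i by have := Ff i; rewrite inE => /andP[/eqP].
split; last by apply/eqP/ffunP => i; rewrite ffunE.
rewrite finset.inE; apply/andP; split.
  by apply/forallP => i; have := Ff i; rewrite inE fe => /andP[_].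
by rewrite -em; apply/eqP/eq_bigr => i _; rewrite fe.
Qed.

End TensorDim.

(** * The total grading is standard graded *)

Section TensorGraded.
Variables (k : fieldType) (n : nat) (R : 'I_n -> comAlgType k) (T : comAlgType k).
Variables (tens : (forall i, R i) -> T) (G : forall i, nat -> set (R i)).
Arguments G : clear implicits.
Hypothesis tensP : is_tensor_product tens.
Hypothesis sg : forall i, standard_graded (G i).
Implicit Types (x y : forall i, R i).

Let tens_lin : multilinear_map tens. Proof. by case: tensP. Qed.
Let tens1 : tens (fun i => 1) = 1. Proof. by case: tensP. Qed.
Let tensM x y : tens (fun i => x i * y i) = tens x * tens y. Proof. by case: tensP. Qed.

Let tG := tensor_grading tens G.

Lemma mem_tensor_grading (e : 'I_n -> nat) x : (forall i, G i (e i) (x i)) ->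
  tG (\sum_i e i)%N (tens x).
Proof. by move=> Gx; apply: sub_lspan; exists e, x. Qed.

Let tG_submod m : submod_closed [in tG m]. Proof. exact: lspan_submod. Qed.

(* These projections yield both the existence and the uniqueness of the
   decomposition of an element of T into homogeneous components. *)
Lemma tensor_proj : exists pi : nat -> {linear T -> T},
  (forall m t, tG m (pi m t)) /\
  (forall m (e : 'I_n -> nat) x, (forall i, G i (e i) (x i)) ->
     pi m (tens x) = if (\sum_i e i == m)%N then tens x else 0).
Proof.
have exh (e : 'I_n -> nat) : exists h : {linear T -> T},
    forall x, h (tens x) = tens (fun i => hcomp (G i) (e i) (x i)).
  by apply: (tens_endo tensP (phi := fun i => hcomp (G i) (e i))) => i; exact: hcomp_linear.
pose h e := sval (cid (exh e)).
have hE e x : h e (tens x) = tens (fun i => hcomp (G i) (e i) (x i)).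
  by rewrite /h; case: cid.
(* The projection to total degree [m] is the sum, over degree vectors of total [m], of the tensor
   products of the component projections. *)
pose pi m t := \sum_(e : {ffun 'I_n -> 'I_m.+1} | (\sum_i e i == m)%N) h (fun i => e i) t.
have lpi m : linear (pi m).
  move=> c u v; rewrite /pi scaler_sumr -big_split /=.
  by apply: eq_bigr => e _; rewrite linearP.
have [pil pilE] : exists pil : nat -> {linear T -> T}, forall m t, pil m t = pi m t.
  by exists (fun m => HB.pack_for {linear T -> T} (pi m) (GRing.isLinear.Build k T T *:%R (pi m) (lpi m))).
exists pil; split.
  move=> m; pose W := [set t | tG m (pil m t)]; suff : forall t, W t by apply.
  apply: (tens_ind tensP).
    apply/submodP; split=> [|c u v Wu Wv]; rewrite /W /=.
      by rewrite (linear0 (pil m)); exact: (submod0 (tG_submod m)).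
    by rewrite (linearP (pil m)); apply: (submodZD (tG_submod m)).
  move=> x; rewrite /W /= pilE; apply: (submod_sum (tG_submod m)) => e /eqP em; rewrite hE -[X in tG X _]em.
  by apply: mem_tensor_grading => i; exact: hcompG.
move=> m e x Gx; rewrite pilE /pi.
case: eqP => [em|nem].
  have eN i : (e i < m.+1)%N by rewrite ltnS -em (bigD1 i) //= leq_addr.
  pose e0 : {ffun 'I_n -> 'I_m.+1} := [ffun i => Ordinal (eN i)].
  have e0m : (\sum_i e0 i == m)%N.
    by apply/eqP; rewrite -[RHS]em; apply: eq_bigr => i _; rewrite ffunE.
  rewrite (bigD1 e0) //= hE big1 ?addr0.
    congr tens; apply: functional_extensionality_dep => i.
    by rewrite (hcomp_id (sg i) _ (Gx i)) ffunE eqxx.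
  move=> e' /andP[_ ne]; rewrite hE.
  have [i ei] : exists i, e' i != e0 i.
    apply/existsP; apply: contraNT ne; rewrite negb_exists => /forallP H.
    by apply/eqP/ffunP => i; have := H i; rewrite negbK => /eqP.
  apply: (multilinear0 tens_lin (i := i)).
  rewrite (hcomp_id (sg i) _ (Gx i)); case: eqP => // E.
  by case/negP: ei; rewrite ffunE -val_eqE /= E.
rewrite big1 // => e' /eqP e'm; rewrite hE.
have [i ei] : exists i, (e' i : nat) != e i.
  apply: contrapT => nex; apply: nem; rewrite -[RHS]e'm; apply: eq_bigr => i _.
  by apply/esym/eqP; apply: contrapT => /negP ne; apply: nex; exists i.
apply: (multilinear0 tens_lin (i := i)).
by rewrite (hcomp_id (sg i) _ (Gx i)) (negbTE ei).
Qed.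

Lemma tensor_grading_mul m m' a b : tG m a -> tG m' b -> tG (m + m')%N (a * b).
Proof.
move=> Ga Gb; have sW := tG_submod (m + m')%N.
suff : tG m `<=` [set a | tG (m + m')%N (a * b)] by apply.
apply: lspan_min.
  apply/submodP; split=> [|c u v Wu Wv] /=; first by rewrite mul0r; exact: (submod0 sW).
  by rewrite mulrDl -scalerAl; apply: (submodZD sW).
move=> _ [e [x [em Gx ->]]] /=.
suff : tG m' `<=` [set b | tG (m + m')%N (tens x * b)] by apply.
apply: lspan_min.
  apply/submodP; split=> [|c u v Wu Wv] /=; first by rewrite mulr0; exact: (submod0 sW).
  by rewrite mulrDr -scalerAr; apply: (submodZD sW).
move=> _ [e' [x' [em' Gx' ->]]] /=.
rewrite -tensM -em -em' -big_split /=.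
by apply: mem_tensor_grading => i; apply: sg_mul.
Qed.

Theorem tensor_standard_graded : standard_graded tG.
Proof.
have [pi [Gpi piE]] := tensor_proj.
have piG m m' t : tG m' t -> pi m t = if m' == m then t else 0.
  suff : tG m' `<=` [set t | pi m t = if m' == m then t else 0] by apply.
  apply: lspan_min.
    apply/submodP; split=> [|c u v /= Wu Wv] /=; first by rewrite linear0 if_same.
    by rewrite linearP Wu Wv; case: ifP; rewrite // scaler0 addr0.
  by move=> _ [e [x [<- Gx ->]]]; exact: piE.
split.
- exact: tG_submod.
- exact: tensor_grading_mul.
- move=> t; suff [N tE] : exists N, forall N', (N <= N')%N -> t = \sum_(m < N') pi m t.
    by exists N, (fun m => pi m t); split => //; exact: tE.
  pose W := [set t | exists N, forall N', (N <= N')%N -> t = \sum_(m < N') pi m t].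
  have sW : submod_closed [in W].
    apply/submodP; split.
      by exists 0%N => N' _; rewrite big1 // => m _; rewrite linear0.
    move=> c u v [N uE] [M vE]; exists (maxn N M) => N'; rewrite geq_max => /andP[NN' MN'].
    rewrite {1}(uE _ NN') {1}(vE _ MN') scaler_sumr -big_split /=.
    by apply: eq_bigr => m _; rewrite linearP.
  suff : forall t, W t by apply.
  apply: (tens_ind tensP) => // x.
  apply: (multilinear_lspan tens_lin (S := fun i => [set a | exists d, G i d a])) => //.
    move=> y /choice[e Ge]; exists (\sum_i e i).+1 => N' eN'.
    rewrite (bigD1 (Ordinal eN')) //= (piE _ _ _ Ge) eqxx big1 ?addr0 // => m.
    by rewrite -val_eqE /= eq_sym (piE _ _ _ Ge) => /negbTE->.
  move=> i; have [N xE] := hcomp_sum (sg i) (x i); rewrite (xE N (leqnn N)).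
  apply: (submod_sum (lspan_submod _)) => d _; apply: sub_lspan; exists d.
  exact: hcompG.
- move=> N c Gc c0 m mN; have : pi m (\sum_(i < N) c i) = 0 by rewrite c0 linear0.
  rewrite linear_sum (bigD1 (Ordinal mN)) //= (piG _ _ _ (Gc m)) eqxx big1 ?addr0 // => i.
  by rewrite -val_eqE /= (piG _ _ _ (Gc i)) => /negbTE->.
- rewrite eqEsubset; split.
    have sW : submod_closed [in [set (c%:A : T) | c in [set: k]]].
      apply/submodP; split; first by exists 0 => //; rewrite scale0r.
      move=> c _ _ [a _ <-] [b _ <-]; exists (c * a + b) => //.
      by rewrite scalerDl scalerA.
    apply: lspan_min => // _ [e [x [em Gx ->]]].
    apply: (multilinear_lspan tens_lin (S := fun i => [set 1])) => //.
      move=> y y1; exists 1 => //; rewrite scale1r -tens1; congr tens.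
      by apply: functional_extensionality_dep => i; rewrite y1.
    move=> i; have e0 : e i = 0%N.
      by move/eqP: em; rewrite sum_nat_eq0 => /forallP/(_ i)/eqP.
    have := Gx i; rewrite e0 (sg_deg0 (sg i)) => -[c _ <-].
    by apply: (submodZ (lspan_submod _)); apply: sub_lspan.
  move=> _ [c _ <-]; apply: (submodZ (tG_submod 0%N)); rewrite -tens1.
  have := @mem_tensor_grading (fun=> 0%N) (fun=> 1); rewrite big1 //; apply.
  by move=> i; rewrite (sg_deg0 (sg i)); exists 1 => //; exact: scale1r.
- have exs i : exists s : seq (R i), [set` s] `<=` G i 1%N /\
    smallest (fun B : set (R i) => subalg_closed [in B]) [set` s] = [set: R i].
    exact: (sg_gen (sg i)).
  pose s i := sval (cid (exs i)).
  have [s1 sT] : (forall i, [set` s i] `<=` G i 1%N) /\ (forall i,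
    smallest (fun B : set (R i) => subalg_closed [in B]) [set` s i] = [set: R i]).
    by split=> i; rewrite /s; case: cid => ? [].
  (* Generators of the factors, placed in one slot with 1 elsewhere, have degree 1; they generate
     because a pure tensor is the product of its slots ([tens_split]). *)
  pose one i a := tens (dfwith (fun=> 1) i a).
  exists (flatten [seq [seq one i a | a <- s i] | i <- enum 'I_n]); split.
    move=> _ /= /flattenP[_ /mapP[i _ ->] /mapP[a ai ->]].
    have := @mem_tensor_grading (fun j => (j == i) : nat) (dfwith (fun=> 1) i a).
    rewrite (bigD1 i) //= eqxx big1 ?addn0; last by move=> j /negbTE->.
    apply=> j; case: dfwithP => [|j' ij]; first by rewrite eqxx; apply: s1.
    rewrite eq_sym (negbTE ij) (sg_deg0 (sg j')); exists 1 => //; exact: scale1r.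
  rewrite eqEsubset; split => // t _ B [[B1 BZ BM] sB].
  move: B1; rewrite inE => B1.
  have BZ' c u v : B u -> B v -> B (c *: u + v) by have := BZ c u v; rewrite !inE; auto.
  have BM' u v : B u -> B v -> B (u * v) by have := BM u v; rewrite !inE; auto.
  have B0 : B 0 by have := BZ' (-1) _ _ B1 B1; rewrite scaleN1r addNr.
  move: t; apply: (tens_ind tensP); first exact/submodP.
  move=> x; rewrite (tens_split tensP); apply: (big_ind B) => // i _.
  have : [set: R i] (x i) by [].
  rewrite -(sT i); suff : smallest (fun B : set (R i) => subalg_closed [in B]) [set` s i]
    `<=` [set a | B (one i a)] by apply.
  move=> a; apply; split.
    split.
    + by rewrite inE /= /one; have -> : dfwith (fun=> 1) i 1 = (fun j => 1 : R j);
        [exact: (dfwith_id (fun j => 1 : R j) i)|rewrite tens1].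
    + move=> c u v; rewrite !inE /= /one => Bu Bv.
      by rewrite (@tens_lin i (fun=> 1) c u v); apply: BZ'.
    + move=> u v; rewrite !inE /= /one => Bu Bv.
      have -> : dfwith (fun=> 1) i (u * v) =
          (fun j => dfwith (fun=> 1) i u j * dfwith (fun=> 1) i v j).
        rewrite dfwith_mul; have -> // : (fun j => 1 * 1) = (fun j => 1 : R j).
        by apply: functional_extensionality_dep => j; rewrite mul1r.
      by rewrite tensM; apply: BM'.
  move=> {}a ai /=; apply: sB; apply/flattenP.
  exists [seq one i a | a <- s i]; last exact: map_f.
  by apply/mapP; exists i => //; rewrite mem_enum.
Qed.

End TensorGraded.

(** * Krull dimension of the tensor product *)

Section KrullDim.
Variable A : comNzRingType.

Lemma has_prime_chain_leq d d' : (d' <= d)%N -> has_prime_chain A d -> has_prime_chain A d'.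
Proof.
move=> dd' [P [pP PS]]; exists P; split=> i id'; [apply: pP|apply: PS].
  exact: leq_trans dd'.
exact: leq_trans dd'.
Qed.

(** Positivity rules out the default value 0, so the value comes from an actual maximal length. *)
Lemma krull_dimP d : (0 < d)%N -> krull_dim A = d ->
  has_prime_chain A d /\ ~ has_prime_chain A d.+1.
Proof.
rewrite /krull_dim => d0; case: xgetP => [d' _ /= Hd <- //|_ d0'].
by rewrite -d0' in d0.
Qed.

Lemma krull_dimE d : has_prime_chain A d -> ~ has_prime_chain A d.+1 -> krull_dim A = d.
Proof.
move=> cd ncd; rewrite /krull_dim; case: xgetP => [d' _ /= [cd' ncd']|/(_ d)]; last by case.
apply/eqP; rewrite eqn_leq; apply/andP; split; rewrite leqNgt; apply/negP => lt.
  by apply: ncd; apply: has_prime_chain_leq cd'.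
by apply: ncd'; apply: has_prime_chain_leq cd.
Qed.

End KrullDim.

Section HilbertSum.
Variables (k : fieldType) (A : comAlgType k) (G : nat -> set A).
Hypothesis sg : standard_graded G.

Definition hilbert_sum m := (\sum_(j < m.+1) dim_mod (G j) [set (0 : A)%R])%N.

Lemma hilbert_sum_mono m m' : (m <= m')%N -> (hilbert_sum m <= hilbert_sum m')%N.
Proof.
rewrite -ltnS => mm'; rewrite /hilbert_sum (big_ord_widen _ (fun j => dim_mod (G j) [set (0 : A)%R]) mm').
by rewrite big_mkcond; apply: leq_sum => i _; case: ifP.
Qed.

Lemma homogeneous_zero : homogeneous_ideal G [set 0].
Proof.
apply/(homogeneousP sg); split.
  split=> // [a b -> ->|a b ->]; first exact: addr0.
  by rewrite /= mulr0.
by move=> a m ->; rewrite (linear0 (hcomp G m)).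
Qed.

Lemma hilbert_sum_upper d : ~ has_prime_chain A d ->
  exists C, forall m, (hilbert_sum m <= C * growth_bound d m)%N.
Proof.
move=> nc; apply: (growth_upper sg homogeneous_zero).
by move=> [P [pP PS _]]; apply: nc; exists P.
Qed.

(** The right-hand side is (j + 1) ... (j + d), all of whose factors are at least j + 1. *)
Lemma exp_leq_bin_fact j d : (j.+1 ^ d <= 'C(j + d, d) * d`!)%N.
Proof.
rewrite bin_ffact; elim: d => [|d IHd]; first by rewrite expn0 ffactn0.
by rewrite addnS ffactSS expnS leq_mul // ltnS leq_addr.
Qed.

Lemma hilbert_sum_lower d : has_prime_chain A d -> exists2 s, (0 < s)%N &
  forall j, (j.+1 ^ d <= d`! * hilbert_sum (s * j))%N.
Proof.
move=> /(chain_growth sg)[s s0 sP]; exists s => // j.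
apply: leq_trans (exp_leq_bin_fact j d) _.
by rewrite mulnC leq_mul2l; apply/orP; right; exact: sP.
Qed.

End HilbertSum.

Lemma leq_exp_base m m' e : (m <= m')%N -> (m ^ e <= m' ^ e)%N.
Proof. by case: e => [|e] mm' //; rewrite leq_exp2r. Qed.

(** Fails at [j = K]. *)
Lemma expS_not_bounded d K : ~ forall j, (j.+1 ^ d.+1 <= K * j.+1 ^ d)%N.
Proof. by move=> /(_ K); rewrite expnS leq_pmul2r ?expn_gt0 // ltnn. Qed.

Section TensorKrullDim.
Variables (k : fieldType) (n : nat) (R : 'I_n -> comAlgType k) (T : comAlgType k).
Variables (tens : (forall i, R i) -> T) (G : forall i, nat -> set (R i)).
Arguments G : clear implicits.
Hypothesis tensP : is_tensor_product tens.
Hypothesis sg : forall i, standard_graded (G i).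

Let tG := tensor_grading tens G.
Let sT : standard_graded tG := tensor_standard_graded tensP sg.
Let h i d := dim_mod (G i d) [set 0].

(** The bound [N] in [tensor_dim] does not depend on the degree, so the sums for all degrees up to
    [M] share one index type and merge. *)
Lemma tensor_hilbert_sum M N : (M < N)%N ->
  hilbert_sum tG M =
  (\sum_(e : {ffun 'I_n -> 'I_N} | \sum_i e i < M.+1) \prod_i h i (e i))%N.
Proof.
move=> MN; rewrite /hilbert_sum.
under eq_bigr => j _.
  rewrite -(box_zero tensP) (@tensor_dim _ _ _ _ _ G tensP sg _ N); last first.
  - by apply: leq_trans MN; exact: ltn_ord.
  - by move=> i; apply: homogeneous_zero.
  over.
rewrite (exchange_big_dep (fun e : {ffun 'I_n -> 'I_N} => \sum_i e i < M.+1)%N) /=; last first.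
  by move=> j e _ /eqP->.
by apply: eq_bigr => e eM; rewrite (big_pred1 (Ordinal eM)) // => j; rewrite eq_sym.
Qed.

(** Degree vectors of total at most [m] lie in the cube of side [m], which in turn lies in the
    simplex of total [n * m]. The two counts agree up to a constant rescaling of [m], which does not
    change orders of growth. *)
Lemma tensor_hilbert_sum_upper m : (hilbert_sum tG m <= \prod_i hilbert_sum (G i) m)%N.
Proof.
rewrite (tensor_hilbert_sum (ltnSn m)) /hilbert_sum.
rewrite (bigA_distr_bigA (fun i (d : 'I_m.+1) => h i d)).
by rewrite big_mkcond; apply: leq_sum => e _; case: ifP.
Qed.

Lemma tensor_hilbert_sum_lower m : (\prod_i hilbert_sum (G i) m <= hilbert_sum tG (n * m))%N.
Proof.
pose N := (n * m + m).+1.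
have le : (m.+1 <= N)%N by rewrite ltnS leq_addl.
rewrite (@tensor_hilbert_sum _ N); last by rewrite ltnS leq_addr.
rewrite /hilbert_sum; under eq_bigr => i _.
  rewrite (big_ord_widen N (fun j => dim_mod (G i j) [set (0 : R i)%R]) le); over.
rewrite /= (bigA_distr_big (fun d : 'I_N => d < m.+1)%N (fun i (d : 'I_N) => h i d)).
rewrite [X in (X <= _)%N]big_mkcond [X in (_ <= X)%N]big_mkcond.
apply: leq_sum => e _; case: ifP => // /ffun_onP em; case: ifP => // /negbT/negP[].
rewrite ltnS; have -> : (n * m = \sum_(i < n) m)%N by rewrite sum_nat_const card_ord.
by apply: leq_sum => i _; exact: (em i).
Qed.

Theorem tensor_prime_chain (d : 'I_n -> nat) :
  (forall i, has_prime_chain (R i) (d i) /\ ~ has_prime_chain (R i) (d i).+1) ->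
  has_prime_chain T (\sum_i d i) /\ ~ has_prime_chain T (\sum_i d i).+1.
Proof.
move=> dP; set D := (\sum_i d i)%N; split.
  apply: contrapT => /(hilbert_sum_upper sT)[C CP].
  have /choice[s sP] : forall i, exists s, forall j,
      (j.+1 ^ d i <= (d i)`! * hilbert_sum (G i) (s * j))%N.
    by move=> i; have [s _ H] := hilbert_sum_lower (sg i) (dP i).1; exists s.
  pose s' := (\max_i s i)%N; pose F := (\prod_i (d i)`!)%N.
  have key j : (j.+1 ^ D <= F * (C * growth_bound D (n * (s' * j))))%N.
    apply: (@leq_trans (F * hilbert_sum tG (n * (s' * j)))%N); last by rewrite leq_mul2l CP orbT.
    apply: leq_trans (_ : _ <= F * \prod_i hilbert_sum (G i) (s' * j))%N _; last first.
      by rewrite leq_mul2l tensor_hilbert_sum_lower orbT.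
    rewrite /F -big_split /= /D expn_sum; apply: leq_prod => i _.
    apply: leq_trans (sP i j) _; rewrite leq_mul2l; apply/orP; right.
    by apply: hilbert_sum_mono; rewrite leq_mul2r (leq_bigmax i) orbT.
  (* For [D = 0] the upper bound is 0, against the value 1 at [j = 0]; otherwise an exponent is
     exceeded by one. *)
  case: D key {CP} => [|D] key; first by have := key 0%N; rewrite /= !muln0.
  apply: (@expS_not_bounded D (F * (C * (n * s').+1 ^ D))) => j.
  apply: leq_trans (key j) _; rewrite /= -!mulnA !leq_mul2l -expnMn.
  by apply/orP; right; apply/orP; right; apply: leq_exp_base; nia.
move=> /(hilbert_sum_lower sT)[s s0]; move: (D.+1`!)%N => F sP.
have /choice[C CP] : forall i, exists C, forall m, (hilbert_sum (G i) m <= C * m.+1 ^ d i)%N.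
  by move=> i; have [C H] := hilbert_sum_upper (sg i) (dP i).2; exists C.
apply: (@expS_not_bounded D (F * (\prod_i C i * s ^ D))) => j.
apply: leq_trans (sP j) _; rewrite -!mulnA leq_mul2l -expnMn; apply/orP; right.
apply: leq_trans (tensor_hilbert_sum_upper _) _.
apply: leq_trans (_ : _ <= \prod_i (C i * (s * j).+1 ^ d i))%N _; first exact: leq_prod.
rewrite big_split /= -expn_sum leq_mul2l; apply/orP; right.
by apply: leq_exp_base; nia.
Qed.

End TensorKrullDim.

(** * Frobenius powers in high degree *)

Section HighDegree.
Variables (k : fieldType) (A : comAlgType k) (G : nat -> set A) (I : set A).
Hypotheses (sg : standard_graded G) (hI : homogeneous_ideal G I).

(** One degree contained in [I] suffices, since longer words have a prefix of that length. If there
    were none, ideals cut out by conditions in low degrees would give chains above [I] of every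
    length. *)
Lemma finite_colength_high_degree : finite_colength I ->
  exists M, forall m, (M <= m)%N -> G m `<=` I.
Proof.
move=> [N nN]; have [iI hI'] := (homogeneousP sg _).1 hI.
suff [m0 Gm0] : exists m0, G m0 `<=` I.
  exists m0 => m m0m; have [s [s1 sm]] := sg_words sg.
  apply: subset_trans (sm m) _; apply: lspan_min; first exact: ideal_submod.
  move=> _ [w [ws wm] <-]; rewrite -(cat_take_drop m0 w) big_cat.
  apply: ideal_mulr => //; apply: Gm0.
  rewrite -[X in G X](_ : size (take m0 w) = m0); last by rewrite size_takel // wm.
  by apply: (word_G sg s1) => x /mem_take; exact: ws.
apply: contrapT => nG; apply: nN.
(* Each step drops the condition in degree [N - j - 1]; it is strict because some element of that
   degree is outside [I]. *)
exists (fun j => [set a | forall i, (i < N - j)%N -> I (hcomp G i a)]); split.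
  move=> j jN; split; last by move=> a Ia i _; exact: hI'.
  split.
  - by move=> i _; rewrite (linear0 (hcomp G i)) //; exact: (ideal0 iI).
  - by move=> a b Ia Ib i ij; rewrite linearD //; apply: (idealD iI); [exact: Ia|exact: Ib].
  - move=> a b Ib i ij; rewrite (hcompM sg). apply: (ideal_sum _ iI) => l _.
    by apply: (idealM _ iI) => //; apply: Ib; apply: leq_ltn_trans ij; exact: leq_subr.
move=> j jN; split.
  by move=> a Ia i ij; apply: Ia; lia.
move=> JJ; apply: nG; exists (N - j).-1 => a Ga.
have ja : (N - j.+1)%N = (N - j).-1 by lia.
have -> : a = hcomp G (N - j).-1 a by rewrite (hcomp_id sg _ Ga) eqxx.
apply: (JJ a) => /= [i|]; last by lia.
rewrite ja => ij; rewrite (hcomp_id sg _ Ga) ltn_eqF //; exact: (ideal0 iI).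
Qed.

Lemma size_leq_sum_count (s w : seq A) : {subset w <= s} ->
  (size w <= \sum_(x <- s) count_mem x w)%N.
Proof.
elim: w => [|y w IHw] ws; first by [].
rewrite /= big_split /= -add1n; apply: leq_add; last first.
  by apply: IHw => x xw; apply: ws; rewrite inE xw orbT.
have : (0 < count_mem y s)%N by rewrite -has_count has_pred1 ws // mem_head.
rewrite -sum1_count big_mkcond => /leq_trans; apply.
by apply: leq_sum => x _ /=; rewrite eq_sym; case: eqP.
Qed.

(* A word that is long compared with q contains some letter at least M q times. *)
Lemma frobenius_high_degree M : (forall m, (M <= m)%N -> G m `<=` I) ->
  exists C, forall q m, (0 < q)%N -> (C * q <= m)%N -> G m `<=` frobenius_power I q.
Proof.
move=> GM; have [s [s1 sm]] := sg_words sg.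
(* Pigeonhole: if no letter occurred more than [M * q] times, the word would have length at most
   [size s * M * q], which is less than [m]. *)
exists (size s * M).+1 => q m q0 mC.
have iF := ideal_gen_ideal [set a ^+ q | a in I].
apply: subset_trans (sm m) _; apply: lspan_min; first exact: ideal_submod.
move=> _ [w [ws wm] <-].
have [x xs xc] : exists2 x, x \in s & (M * q < count_mem x w)%N.
  apply: contrapT => nex.
  have : (size w <= \sum_(x <- s) M * q)%N.
    apply: leq_trans (size_leq_sum_count ws) _; rewrite big_seq [X in (_ <= X)%N]big_seq.
    apply: leq_sum => x xs; rewrite leqNgt; apply/negP => xc; apply: nex; by exists x.
  by rewrite big_const_seq count_predT iter_addn addn0 wm; nia.
rewrite -prodr_undup_exp_count.
have xw : x \in w by rewrite -has_pred1 has_count; exact: leq_ltn_trans xc.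
rewrite (bigD1_seq x) ?mem_undup ?undup_uniq //=; apply: (ideal_mulr _ iF).
(* From the power of [x] one splits off the [q]-th power of [x ^+ M], which has degree [M] and so
   lies in [I]. *)
rewrite -(subnK (ltnW xc)) exprD; apply: (idealM _ iF); rewrite exprM.
apply: sub_ideal_gen; exists (x ^+ M) => //; apply: (GM M) => //.
have := word_G sg s1 (w := nseq M x); rewrite size_nseq big_nseq iter_mulr_1; apply.
by move=> y; rewrite mem_nseq => /andP[_ /eqP->].
Qed.

(** Additivity of the [q]-th power turns [a ^+ q] into the sum of the [q]-th powers of the
    components of [a], which are homogeneous and generated from [I]. *)
Lemma frobenius_homogeneous (p e : nat) : p \in [pchar k] ->
  homogeneous_ideal G (frobenius_power I (p ^ e)).
Proof.
move=> pk; set q := (p ^ e)%N; have [iI hI'] := (homogeneousP sg _).1 hI.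
have iF := ideal_gen_ideal [set a ^+ q | a in I].
have pA : p \in [pchar A] by exact: (rmorph_pchar (in_alg A)).
have qA : [pchar A].-nat q by rewrite pnatX pnatE ?pA //; case/andP: pk.
apply/(homogeneousP sg); split => // a m Fa; move: a Fa m.
suff : frobenius_power I q `<=` [set a | forall m, frobenius_power I q (hcomp G m a)] by [].
apply: ideal_gen_min.
  split.
  - by move=> m; rewrite (linear0 (hcomp G m)) //; exact: (ideal0 iF).
  - by move=> a b Fa Fb m; rewrite linearD //; apply: (idealD iF); [exact: Fa|exact: Fb].
  - move=> a b Fb m; rewrite (hcompM sg); apply: (ideal_sum _ iF) => l _.
    by apply: (idealM _ iF); exact: Fb.
move=> _ [a Ia <-] m; have [N aE] := hcomp_sum sg a.
have -> : a ^+ q = \sum_(i < N) hcomp G i a ^+ q.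
  rewrite [in LHS](aE N (leqnn N)).
  apply: (big_morph (fun x => x ^+ q)) => [x y|]; first exact: exprDn_pchar.
  by rewrite expr0n gtn_eqF //; case/andP: qA.
rewrite linear_sum //; apply: (ideal_sum _ iF) => i _.
have GX : G (i * q)%N (hcomp G i a ^+ q).
  elim: (q) => [|r IHr]; first by rewrite muln0 (sg_deg0 sg); exists 1 => //; rewrite scale1r expr0.
  by rewrite mulnS exprS; apply: sg_mul => //; exact: hcompG.
rewrite /= (hcomp_id sg _ GX); case: ifP => _; last exact: (ideal0 iF).
by apply: sub_ideal_gen; exists (hcomp G i a) => //; exact: hI'.
Qed.

End HighDegree.

(** * Discrete and continuous convolution *)

Section Integrals.
Variable K : realType.
Notation mu := (@lebesgue_measure K).
Implicit Types (f g h : K -> K).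

(** Half-open intervals are used because consecutive cells of the Riemann sums then partition the
    range. *)
Lemma continuous_itvco_integrable h (a b : K) : continuous h ->
  mu.-integrable `[a, b[ (EFin \o h).
Proof.
move=> ch; apply: (@integrableS _ _ _ mu `[a, b]) => //.
  exact: subset_itv_co_cc.
apply: continuous_compact_integrable; first exact: segment_compact.
exact: continuous_subspaceT.
Qed.

Lemma Rintegral_itvco_approx h (a b c eta : K) : a <= b -> continuous h ->
  (forall y, a <= y < b -> `|h y - c| <= eta) ->
  `|\int[mu]_(y in `[a, b[) h y - c * (b - a)| <= eta * (b - a).
Proof.
move=> ab ch hc; have ih := continuous_itvco_integrable a b ch.
have cst (r : K) : \int[mu]_(y in `[a, b[) r = r * (b - a).
  rewrite Rintegral_cst // [X in fine X](_ : _ = lebesgue_measure [set` `[a, b[]) //.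
  rewrite lebesgue_measure_itv /= lte_fin.
  case: ltP => //= ba; have -> : a = b by apply/le_anti; rewrite ab.
  by rewrite subrr.
have icst (r : K) : mu.-integrable `[a, b[ (EFin \o (fun=> r)).
  by apply: continuous_itvco_integrable => x; exact: cvg_cst.
rewrite ler_norml.
apply/andP; split.
  suff : (c - eta) * (b - a) <= \int[mu]_(y in `[a, b[) h y by lra.
  rewrite -cst; apply: le_Rintegral => // y /=; rewrite in_itv /= => /hc.
  by rewrite ler_norml => /andP[]; lra.
suff : \int[mu]_(y in `[a, b[) h y <= (c + eta) * (b - a) by lra.
rewrite -cst; apply: le_Rintegral => // y /=; rewrite in_itv /= => /hc.
by rewrite ler_norml => /andP[]; lra.
Qed.

(** Each cell contributes an error of at most [eta / Q]. The samples [c a] need not be values of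
    [h], which allows products of lengths in their place. *)
Lemma Rintegral_riemann h (Q : K) (L : nat) (c : nat -> K) (eta : K) : 0 < Q ->
  continuous h ->
  (forall a y, (a < L)%N -> a%:R / Q <= y < a.+1%:R / Q -> `|h y - c a| <= eta) ->
  `|\int[mu]_(y in `[0, L%:R / Q[) h y - Q^-1 * \sum_(a < L) c a| <= eta * (L%:R / Q).
Proof.
move=> Q0 ch; elim: L => [|L IHL] hc.
  by rewrite mul0r set_itvco0 Rintegral_set0 big_ord0 !mulr0 subrr normr0.
have Qi : 0 < Q^-1 by rewrite invr_gt0.
have LQ : 0 <= L%:R / Q :> K by rewrite divr_ge0 // ltW.
have LS : L%:R / Q <= L.+1%:R / Q :> K by rewrite ler_pM2r // ler_nat.
rewrite (@itv_bndbnd_setU _ _ (BLeft 0) (BLeft (L%:R / Q)) (BLeft (L.+1%:R / Q))) ?bnd_simp //.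
rewrite Rintegral_setU //=; last 2 first.
- rewrite -itv_bndbnd_setU ?bnd_simp //; exact: continuous_itvco_integrable.
- rewrite disj_set2E; apply/eqP/seteqP; split=> // y [] /=; rewrite !in_itv /=; lra.
have H1 := IHL (fun a y aL => hc a y (ltnW aL)).
have H2 := Rintegral_itvco_approx LS ch (fun y => hc L y (ltnSn L)).
rewrite big_ord_recr /= mulrDr.
have E : L.+1%:R / Q - L%:R / Q = Q^-1 by rewrite -mulrBl -natrB // subSnn mul1r.
rewrite E in H2; rewrite [X in _ <= _ * X](_ : _ = L%:R / Q + Q^-1); last by rewrite -natr1 mulrDl mul1r.
rewrite [Q^-1 * c L]mulrC opprD addrACA mulrDr.
by apply: le_trans (ler_normD _ _) _; apply: lerD.
Qed.

Lemma Rintegral_support h (a b : K) : (forall y, y < a \/ b <= y -> h y = 0) ->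
  \int[mu]_y h y = \int[mu]_(y in `[a, b[) h y.
Proof.
move=> h0; rewrite [RHS]Rintegral_mkcond; apply: eq_Rintegral => y _.
rewrite patchE; case: ifP => // /negbT; rewrite notin_setE /= in_itv /= => /negP.
by rewrite negb_and -ltNge -leNgt => /orP H; apply: h0.
Qed.

Lemma compact_support_bounded f (C : K) : 0 <= C -> continuous f ->
  (forall x, x <= 0 -> f x = 0) -> (forall x, C <= x -> f x = 0) ->
  exists2 B, 0 <= B & forall x, `|f x| <= B.
Proof.
move=> C0 cf f0 fC.
have cnf : {within `[0, C], continuous (fun x => `|f x|)}.
  by apply: continuous_subspaceT => x; apply: continuous_comp; [exact: cf|exact: norm_continuous].
have [c _ cmax] := EVT_max C0 cnf.
exists `|f c| => // x.
have [x0|x0] := leP x 0; first by rewrite f0 // normr0.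
have [xC|xC] := leP C x; first by rewrite fC // normr0.
by apply: cmax; rewrite in_itv /= !ltW.
Qed.

(** Compactness in its near-covering form, with parameter [d] tending to 0 from the right, turns
    local moduli into one. The margins of 1 and [d <= 1] ensure that if [x] leaves the enlarged
    segment, [y] is outside the support too. *)
Lemma compact_support_unif_continuous f (C : K) : continuous f ->
  (forall x, x <= 0 -> f x = 0) -> (forall x, C <= x -> f x = 0) ->
  forall eps, 0 < eps -> exists2 delta, 0 < delta &
    forall x y, `|x - y| <= delta -> `|f x - f y| <= eps.
Proof.
move=> cf f0 fC eps eps0.
have /compact_near_coveringP cov := @segment_compact K (-1) (C + 1).
have := cov K (0^'+) (fun d x => forall y, `|x - y| <= d -> `|f x - f y| <= eps) _.
case=> [|].
  move=> x _; have eps2 : 0 < eps / 2 by rewrite divr_gt0.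
  have /cvgrPdist_lt/(_ _ eps2)/nbhs_ballP[r /= r0 rP] := cf x.
  have r2 : 0 < r / 2 by rewrite divr_gt0.
  exists (ball x (r / 2), [set d | d < r / 2]); first split => /=.
  - exact: nbhsx_ballx.
  - exact: nbhs_right_lt.
  move=> [x' d] /= [xx' dr] y x'y.
  have H1 : `|f x - f x'| < eps / 2 by apply: rP; rewrite /ball /=; move: xx'; rewrite /ball /=; lra.
  have H2 : `|f x - f y| < eps / 2.
    apply: rP; rewrite /ball /=; move: xx'; rewrite /ball /= => xx'.
    have := ler_normD (x - x') (x' - y); rewrite addrA subrK; lra.
  have := ler_normD (f x' - f x) (f x - f y); rewrite addrA subrK [`|f x' - f x|]distrC; lra.
move=> e /= e0 He; pose d := Num.min (e / 2) 1.
have d0 : 0 < d by rewrite lt_min ltr01 divr_gt0.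
have d1 : d <= 1 by rewrite ge_min lexx orbT.
have de : d < e by rewrite gt_min; apply/orP; left; lra.
exists d => // x y xy; have [xab|] := boolP (x \in `[-1, C + 1]).
  apply: (He d) => //.
  by rewrite /ball /= sub0r normrN gtr0_norm.
rewrite in_itv /= negb_and -!ltNge => /orP[x1|xC]; move: (xy); rewrite ler_norml => /andP[l1 l2].
  by rewrite !f0 ?subrr ?normr0 ?(ltW eps0) //; lra.
by rewrite !fC ?subrr ?normr0 ?(ltW eps0) //; lra.
Qed.

End Integrals.

(** * Discrete convolution and its scaling limit *)

Section DiscreteConvolution.
Variable K : realType.
Implicit Types (f g : K -> K).
Notation mu := (@lebesgue_measure K).

(** The weight [1/Q] is the mesh: applied to samples at the points [a/Q], this is a Riemann sum for
    the convolution. *)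
Definition dconv (Q : nat) (u v : nat -> K) (m : nat) : K :=
  Q%:R^-1 * \sum_(a < m.+1) u a * v (m - a)%N.

(** The invariant preserved by convolution. Vanishing is imposed on the sequences themselves, with
    [C] independent of [e], so that a sum has at most [C * Q e] nonzero terms. *)
Record scaled_limit (Q : nat -> nat) (u : nat -> nat -> K) (f : K -> K) (C : nat) : Prop :=
  ScaledLimit {
    sl_cont : continuous f;
    sl_neg : forall x, x <= 0 -> f x = 0;
    sl_supp : forall e m, (C * Q e <= m)%N -> u e m = 0;
    sl_unif : forall eps, 0 < eps -> exists E : nat, forall e, (E <= e)%N ->
      forall x, 0 <= x -> `|f x - u e (Num.truncn ((Q e)%:R * x))| <= eps }.

Variable Q : nat -> nat.
Hypothesis Q_gt0 : forall e, (0 < Q e)%N.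
Hypothesis Q_infty : forall B, exists E, forall e, (E <= e)%N -> (B <= Q e)%N.

Let Q0 e : 0 < (Q e)%:R :> K. Proof. by rewrite ltr0n. Qed.

Lemma sl_zero u f C : scaled_limit Q u f C -> forall x, C%:R <= x -> f x = 0.
Proof.
move=> sl x Cx; apply/eqP; rewrite -normr_le0; apply/ler_addgt0Pr => eps eps0.
have [E /(_ E (leqnn E) x)] := sl_unif sl eps0.
have x0 : 0 <= x by apply: le_trans Cx.
rewrite (sl_supp sl) ?subr0 ?add0r; first exact.
by rewrite truncn_ge_nat ?mulr_ge0 // natrM mulrC ler_pM2l.
Qed.

(** At the point [a/Q] the truncation is exact. *)
Lemma sl_nat u f C eps : scaled_limit Q u f C -> 0 < eps -> exists E : nat,
  forall e, (E <= e)%N -> forall a, `|f (a%:R / (Q e)%:R) - u e a| <= eps.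
Proof.
move=> sl /(sl_unif sl)[E HE]; exists E => e Ee a.
have := HE e Ee (a%:R / (Q e)%:R); rewrite mulrCA divff ?gt_eqF // mulr1 natrK; apply.
by rewrite divr_ge0 // ltW.
Qed.

Section Convolution.
Variables (f g : K -> K) (C D : nat).
Hypotheses (cf : continuous f) (cg : continuous g).
Hypotheses (f0 : forall x, x <= 0 -> f x = 0) (fC : forall x, C%:R <= x -> f x = 0).
Hypotheses (g0 : forall x, x <= 0 -> g x = 0) (gD : forall x, D%:R <= x -> g x = 0).

Lemma convolutionE x : convolution f g x = \int[mu]_(y in `[0, C%:R[) (f y * g (x - y)).
Proof.
apply: Rintegral_support => y [y0|yC]; first by rewrite f0 ?mul0r // ltW.
by rewrite fC ?mul0r.
Qed.

Lemma convolution_neg x : x <= 0 -> convolution f g x = 0.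
Proof.
move=> x0; rewrite convolutionE (@eq_Rintegral _ _ _ mu _ (fun=> 0)); last first.
  move=> y; rewrite inE /= in_itv /= => /andP[y0 _]; rewrite [g _]g0 ?mulr0 //; lra.
by rewrite Rintegral_cst // mul0r.
Qed.

Lemma convolution_integrand_continuous x : continuous (fun y => f y * g (x - y)).
Proof.
move=> y; apply: cvgM; first exact: cf.
apply: continuous_comp; last exact: cg.
by apply: cvgB; [exact: cvg_cst|exact: cvg_id].
Qed.

Lemma convolution_continuous : continuous (convolution f g).
Proof.
have C0 : 0 <= C%:R :> K by [].
have [B B0 fB] := compact_support_bounded C0 cf f0 fC.
move=> x; apply/cvgrPdist_le => eps eps0.
pose eta := eps / ((B + 1) * (C%:R + 1)).
have BC : 0 < (B + 1) * (C%:R + 1) by apply: mulr_gt0; lra.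
have eta0 : 0 < eta by rewrite divr_gt0.
have [delta d0 gd] := compact_support_unif_continuous cg g0 gD eta0.
apply/nbhs_ballP; exists delta => //= x' xx'.
have ih z := continuous_itvco_integrable 0 C%:R (@convolution_integrand_continuous z).
rewrite !convolutionE -RintegralB //.
have ch : continuous (fun y => f y * g (x - y) - f y * g (x' - y)).
  by move=> y; apply: cvgB; exact: convolution_integrand_continuous.
have := @Rintegral_itvco_approx K _ 0 C%:R 0 (B * eta) C0 ch.
rewrite mul0r subr0; set I := Rintegral _ _ _ => H; rewrite subr0 in H.
apply: le_trans (H _) _.
  move=> y _; rewrite subr0 -mulrBr normrM ler_pM //; apply: gd.
  have -> : x - y - (x' - y) = x - x' by ring.
  by apply: ltW.
have : eta * ((B + 1) * (C%:R + 1)) = eps by rewrite divfK // gt_eqF.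
nra.
Qed.

(* The product is compared on each interval [a/Q, (a+1)/Q[ with the sampled
   product; |x - m/Q| and |y - a/Q| are both below 1/Q. *)
Lemma convolution_approx (q : nat) (u v : nat -> K) (Bf Bg eps : K) (x : K) :
  (0 < q)%N -> 0 <= x -> 0 < eps -> eps <= 1 -> 0 <= Bf -> 0 <= Bg ->
  (forall y, `|f y| <= Bf) -> (forall y, `|g y| <= Bg) ->
  (forall y z, `|y - z| <= 2 / q%:R -> `|f y - f z| <= eps) ->
  (forall y z, `|y - z| <= 2 / q%:R -> `|g y - g z| <= eps) ->
  (forall m, (C * q <= m)%N -> u m = 0) ->
  (forall a, `|f (a%:R / q%:R) - u a| <= eps) ->
  (forall a, `|g (a%:R / q%:R) - v a| <= eps) ->
  `|convolution f g x - dconv q u v (Num.truncn (q%:R * x))| <=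
    2 * eps * (Bf + Bg + 2) * C%:R.
Proof.
move=> q0 x0 eps0 eps1 Bf0 Bg0 fB gB fu gu uC uf vg.
set m := Num.truncn _.
have qr : 0 < q%:R :> K by rewrite ltr0n.
have qi : 0 < q%:R^-1 :> K by rewrite invr_gt0.
have /andP[mx xm] : m%:R <= q%:R * x < m.+1%:R by apply: truncn_itv; rewrite mulr_ge0 // ltW.
have mx' : m%:R / q%:R <= x by rewrite ler_pdivrMr // mulrC.
have xm' : x <= m%:R / q%:R + q%:R^-1.
  by rewrite -[X in _ + X]mul1r -mulrDl natr1 ler_pdivlMr // mulrC ltW.
(* Extending by 0 beyond [m] mirrors the vanishing of [g] on negative arguments, and makes the sum
   range over the cells of the segment from 0 to [C]. *)
pose v' a : K := if (a <= m)%N then v (m - a)%N else 0.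
have -> : dconv q u v m = q%:R^-1 * \sum_(a < C * q) u a * v' a.
  congr (_ * _).
  pose M := maxn m.+1 (C * q).
  rewrite (big_ord_widen M (fun a => u a * v (m - a)%N)) ?leq_maxl //.
  rewrite (big_ord_widen M (fun a => u a * v' a)) ?leq_maxr //.
  rewrite big_mkcond [RHS]big_mkcond; apply: eq_bigr => a _ /=.
  rewrite /v' ltnS; case: (ltnP a (C * q)) => aC; last by rewrite uC // mul0r if_same.
  by case: ifP; rewrite ?mulr0.
have E : (C * q)%:R / q%:R = C%:R :> K by rewrite natrM mulfK // gt_eqF.
rewrite convolutionE -E; apply: (@Rintegral_riemann K (fun y => f y * g (x - y)) q%:R (C * q)%N
  (fun a => u a * v' a) (2 * eps * (Bf + Bg + 2)) qr (@convolution_integrand_continuous x)).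
move=> a y _ /andP[ay ya].
have ya' : y < a%:R / q%:R + q%:R^-1 by rewrite -[X in _ + X]mul1r -mulrDl natr1.
have Hf : `|f y - u a| <= 2 * eps.
  have h1 : `|f y - f (a%:R / q%:R)| <= eps.
    by apply: fu; rewrite ler_norml; apply/andP; split; lra.
  have := ler_normD (f y - f (a%:R / q%:R)) (f (a%:R / q%:R) - u a).
  by rewrite addrA subrK; have := uf a; lra.
(* [x - y] is compared with [(m - a)/q]; for [a > m] the latter is negative, where [g] vanishes. *)
have Hg : `|g (x - y) - v' a| <= 2 * eps.
  have h1 : `|g (x - y) - g ((m%:R - a%:R) / q%:R)| <= eps.
    by apply: gu; rewrite mulrBl ler_norml; apply/andP; split; lra.
  have h2 : `|g ((m%:R - a%:R) / q%:R) - v' a| <= eps.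
    rewrite /v'; case: leqP => am; first by rewrite -natrB //; exact: vg.
    rewrite g0 ?subr0 ?normr0 ?(ltW eps0) // pmulr_lle0 // subr_le0 ler_nat; exact: ltnW.
  have := ler_normD (g (x - y) - g ((m%:R - a%:R) / q%:R)) (g ((m%:R - a%:R) / q%:R) - v' a).
  by rewrite addrA subrK; lra.
(* The errors of the two factors are separated; [eps <= 1] absorbs the quadratic term. *)
have -> : f y * g (x - y) - u a * v' a =
  (f y - u a) * g (x - y) + u a * (g (x - y) - v' a) by ring.
apply: le_trans (ler_normD _ _) _; rewrite !normrM.
have Hu : `|u a| <= Bf + eps.
  have := ler_normD (u a - f (a%:R / q%:R)) (f (a%:R / q%:R)).
  by rewrite subrK distrC; have := uf a; have := fB (a%:R / q%:R); lra.
have H1 : `|f y - u a| * `|g (x - y)| <= 2 * eps * Bg by apply: ler_pM.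
have H2 : `|u a| * `|g (x - y) - v' a| <= (Bf + eps) * (2 * eps) by apply: ler_pM.
nra.
Qed.

End Convolution.

Lemma scaled_limit_convolution u v f g C D :
  scaled_limit Q u f C -> scaled_limit Q v g D ->
  scaled_limit Q (fun e => dconv (Q e) (u e) (v e)) (convolution f g) (C + D).
Proof.
move=> su sv.
have [cf f0 uC _] := su; have [cg g0 vD _] := sv.
have fC := sl_zero su; have gD := sl_zero sv.
have [Bf Bf0 fB] := compact_support_bounded (ler0n K C) cf f0 fC.
have [Bg Bg0 gB] := compact_support_bounded (ler0n K D) cg g0 gD.
split.
- exact: (convolution_continuous cf cg f0 fC g0 gD).
- exact: (convolution_neg f0 fC g0).
(* In each term, either [a] is at least [C * Q e] or [m - a] is at least [D * Q e]. *)
- move=> e m mCD; rewrite /dconv big1 ?mulr0 // => a _.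
  case: (leqP (C * Q e) a) => aC; first by rewrite uC ?mul0r.
  by rewrite vD ?mulr0 //; move: mCD; rewrite mulnDl; lia.
(* The constant of [convolution_approx], with [C + 1] for [C] to keep it positive. *)
move=> eps eps0; pose F := 2 * (Bf + Bg + 2) * (C%:R + 1).
have F0 : 0 < F by rewrite !mulr_gt0 //; have : 0 <= C%:R :> K by []; lra.
pose eta := Num.min 1 (eps / F).
have eta0 : 0 < eta by rewrite lt_min ltr01 divr_gt0.
have eta1 : eta <= 1 by rewrite ge_min lexx.
have etaF : eta * F <= eps by rewrite -ler_pdivlMr // ge_min lexx orbT.
have [d1 d10 fd] := compact_support_unif_continuous cf f0 fC eta0.
have [d2 d20 gd] := compact_support_unif_continuous cg g0 gD eta0.
have [E1 HE1] := sl_nat su eta0; have [E2 HE2] := sl_nat sv eta0.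
(* Once [Q e] exceeds [B], the distance [2 / Q e] is below both moduli of continuity. *)
pose B := maxn (Num.truncn (2 / d1)).+1 (Num.truncn (2 / d2)).+1.
have [E3 HE3] := Q_infty B.
exists (maxn E1 (maxn E2 E3)) => e; rewrite !geq_max => /and3P[e1 e2 e3] x x0.
have small (d : K) : 0 < d -> (Num.truncn (2 / d) < Q e)%N -> 2 / (Q e)%:R <= d.
  move=> dp lt.
  have : 2 / d < (Q e)%:R :> K by apply: lt_le_trans (truncnS_gt _) _; rewrite ler_nat.
  by rewrite ltr_pdivrMr // => lt2; rewrite ler_pdivrMr ?Q0 // mulrC ltW.
have /andP[B1 B2] : (Num.truncn (2 / d1) < Q e)%N && (Num.truncn (2 / d2) < Q e)%N.
  by have := HE3 e e3; rewrite geq_max.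
have := @convolution_approx f g C cf cg f0 fC g0 (Q e) (u e) (v e) Bf Bg eta x
  (Q_gt0 e) x0 eta0 eta1 Bf0 Bg0 fB gB.
move=> /(_ (fun y z yz => fd y z (le_trans yz (small _ d10 B1)))).
move=> /(_ (fun y z yz => gd y z (le_trans yz (small _ d20 B2)))).
move=> /(_ (uC e) (HE1 e e1) (HE2 e e2)) /le_trans; apply.
apply: le_trans etaF; rewrite /F; have : 0 <= C%:R :> K by []. 
have : 0 <= eta * (Bf + Bg + 2) by apply: mulr_ge0; lra.
nra.
Qed.

Lemma scaled_limit_fold (us : seq (nat -> nat -> K)) (fs : seq (K -> K)) u f C :
  scaled_limit Q u f C -> size us = size fs ->
  (forall i, (i < size us)%N -> exists D,
     scaled_limit Q (nth (fun _ _ => 0) us i) (nth (fun=> 0) fs i) D) ->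
  exists D, scaled_limit Q
    (fun e => foldl (dconv (Q e)) (u e) [seq w e | w <- us]) (foldl (@convolution K) f fs) D.
Proof.
elim: us fs u f C => [|w us IH] [|h fs] u f C su //= => [_ _|[sE] H].
  by exists C.
have [D sw] := H 0%N isT.
apply: (IH fs (fun e => dconv (Q e) (u e) (w e)) _ (C + D)%N) => //.
  exact: scaled_limit_convolution.
by move=> i il; exact: (H i.+1).
Qed.

(** Discrete convolution multiplies generating polynomials; truncating at [N > m] does not affect
    the coefficient [m]. The nested sums become one symmetric product, and each convolution leaves a
    factor [1/q]. *)
Lemma foldl_dconv (q N : nat) (us : seq (nat -> K)) u m : (m < N)%N ->
  foldl (dconv q) u us m =
  q%:R ^- size us * ((\poly_(j < N) u j) * \prod_(w <- us) \poly_(j < N) w j)`_m.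
Proof.
elim: us u m => [|w us IH] u m mN /=.
  by rewrite expr0 invr1 mul1r big_nil mulr1 coef_poly mN.
rewrite IH // big_cons mulrA exprS invfM [q%:R^-1 / _]mulrC -[RHS]mulrA; congr (_ * _).
rewrite !coefM mulr_sumr; apply: eq_bigr => a _; rewrite mulrA; congr (_ * _).
have aN : (a < N)%N by apply: leq_ltn_trans mN; rewrite -ltnS.
rewrite coef_poly aN /dconv coefM; congr (_ * _); apply: eq_bigr => b _.
have ba : (b <= a)%N by rewrite -ltnS.
by rewrite !coef_poly !ifT // (leq_ltn_trans _ aN) // leq_subr.
Qed.

End DiscreteConvolution.

(** * Hilbert-Kunz density *)

Lemma uniform_cvgP (K : realType) (A : set K) (u : nat -> K -> K) (f : K -> K) :
  {uniform A, u @ \oo --> f} <->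
  (forall eps, 0 < eps -> exists E : nat, forall e, (E <= e)%N ->
     forall x, A x -> `|f x - u e x| <= eps).
Proof.
split=> [cu eps eps0|cu P].
  have /cu [E _ HE] : nbhs (f : {uniform` A -> K}) [set h | forall x, A x -> ball (f x) eps (h x)].
    apply/uniform_nbhs; exists [set xy | ball xy.1 eps xy.2].
    by split=> //; rewrite -entourage_ballE; exists eps.
  exists E => e Ee x Ax; apply: ltW; exact: (HE e Ee x Ax).
move=> /uniform_nbhs[B [entB BP]].
move: entB; rewrite -entourage_ballE => -[eps /= eps0 epsB].
have [|E HE] := cu (eps / 2); first by rewrite divr_gt0.
exists E => // e Ee; apply: BP => x Ax; apply: epsB; rewrite /= /ball /=.
by apply: le_lt_trans (HE e Ee x Ax) _; rewrite ltr_pdivrMr // ltr_pMr // ltr1n.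
Qed.

Lemma compact_support (K : realType) (f : K -> K) (C : K) :
  (forall x, x <= 0 -> f x = 0) -> (forall x, C <= x -> f x = 0) ->
  compact (closure [set x | f x != 0]).
Proof.
move=> f0 fC; apply: (subclosed_compact _ (@segment_compact K 0 C)); first exact: closed_closure.
have cI : closed `[0, C]%classic by exact: itv_closed.
rewrite [X in _ `<=` X](closure_id _).1 //; apply: closure_subset => x /= fx.
rewrite in_itv /=; apply/andP; split; rewrite leNgt; apply/negP => H.
  by move: fx; rewrite f0 ?eqxx // ltW.
by move: fx; rewrite fC ?eqxx // ltW.
Qed.

(** The expansion runs over the same degree vectors as [tensor_dim]. *)
Lemma coef_prod_poly (K : comNzRingType) (n N m : nat) (u : 'I_n -> nat -> K) :
  (\prod_i \poly_(j < N) u i j)`_m =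
  \sum_(e : {ffun 'I_n -> 'I_N} | (\sum_i e i == m)%N) \prod_i u i (e i).
Proof.
under eq_bigr do rewrite poly_def.
rewrite (bigA_distr_bigA (fun i (j : 'I_N) => u i j *: 'X^j)) coef_sum [RHS]big_mkcond /=.
apply: eq_bigr => e _.
rewrite scaler_prod coefZ -expr_sum coefXn eq_sym.
by case: eqP; rewrite ?mulr1 ?mulr0.
Qed.

Section Density.
Variables (K : realType) (p : nat) (k : fieldType).
Hypothesis pk : p \in [pchar k].

(** [hk_seq] as a function of the integer degree, before the rescaling by [q]. *)
Definition hk_length (A : comAlgType k) (G : nat -> set A) (I : set A) (e m : nat) : K :=
  ((p ^ e)%:R ^+ (krull_dim A).-1)^-1 * (dim_mod (G m) (frobenius_power I (p ^ e)))%:R.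

(** Finite colength provides the constant [C], uniform in the Frobenius exponent; the rest is
    contained in the definition of the density. *)
Lemma density_scaled_limit (A : comAlgType k) (G : nat -> set A) (I : set A) (f : K -> K) :
  standard_graded G -> homogeneous_ideal G I -> finite_colength I ->
  is_hk_density p G I f -> exists C, scaled_limit (fun e => (p ^ e)%N) (hk_length G I) f C.
Proof.
move=> sg hI fI [cu f0 cf _].
have [M GM] := finite_colength_high_degree sg hI fI.
have [C GC] := frobenius_high_degree sg GM.
have p0 e : (0 < p ^ e)%N by rewrite expn_gt0 prime_gt0 //; case/andP: pk.
exists C; split => //.
- move=> e m mC; rewrite /hk_length dim_mod_eq0 ?mulr0 //; first exact: ideal_gen_ideal.
  by apply: GC mC.
- exact/uniform_cvgP.
Qed.

Variables (n : nat) (R : 'I_n.+1 -> comAlgType k) (G : forall i, nat -> set (R i)).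
Arguments G : clear implicits.
Variables (I : forall i, set (R i)).
Arguments I : clear implicits.
Variables (T : comAlgType k) (tens : (forall i, R i) -> T).
Hypothesis tensP : is_tensor_product tens.
Hypothesis sg : forall i, standard_graded (G i).
Hypothesis hI : forall i, homogeneous_ideal (G i) (I i).
Hypothesis dim_gt0 : forall i, (0 < krull_dim (R i))%N.

Lemma krull_dim_tensor : krull_dim T = (\sum_i krull_dim (R i))%N.
Proof.
have [H1 H2] := tensor_prime_chain tensP sg (fun i => krull_dimP (dim_gt0 i) (erefl _)).
exact: krull_dimE.
Qed.

(** Exponents match because the [n] convolutions contribute [n] to the sum of the [d_i - 1] over
    [n + 1] factors, which gives the total dimension minus 1; this needs every [d_i] to be
    positive. *)
Lemma hk_length_tensor e m :
  hk_length (tensor_grading tens G) (box_ideal tens I) e m =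
  foldl (dconv (p ^ e)) (hk_length (G ord0) (I ord0) e)
    [seq hk_length (G (lift ord0 i)) (I (lift ord0 i)) e | i : 'I_n] m.
Proof.
have iI i : is_ideal (I i) by case: (hI i).
rewrite (foldl_dconv _ _ _ (ltnSn m)) size_map size_enum_ord big_map.
rewrite big_enum /= -(big_ord_recl _ (fun i => \poly_(j < m.+1) hk_length (G i) (I i) e j)).
rewrite (@coef_prod_poly K _ _ _ (fun i => hk_length (G i) (I i) e)).
rewrite {1}/hk_length (frobenius_power_box tensP e pk iI).
rewrite (tensor_dim tensP sg _ (ltnSn m)); last first.
  by move=> i; apply: frobenius_homogeneous.
under [in RHS]eq_bigr do rewrite big_split /=.
rewrite -mulr_sumr mulrA natr_sum; congr (_ * _); last first.
  by apply: eq_bigr => g _; rewrite natr_prod.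
rewrite prodfV -expr_sum -invfM -exprD; congr (_ ^+ _)^-1.
rewrite krull_dim_tensor.
have -> : (\sum_i krull_dim (R i) = \sum_(i < n.+1) ((krull_dim (R i)).-1 + 1))%N.
  by apply: eq_bigr => i _; rewrite addn1 prednK.
by rewrite big_split /= sum_nat_const card_ord muln1 addnS /= addnC.
Qed.

End Density.

Theorem theorem1p1 (K : realType) (p : nat) (k : fieldType) (n : nat)
    (R : 'I_n.+1 -> comAlgType k) (G : forall i, nat -> set (R i))
    (I : forall i, set (R i))
    (T : comAlgType k) (tens : (forall i, R i) -> T)
    (f : 'I_n.+1 -> K -> K) :
  perfect_field p k ->
  (forall i, standard_graded (G i)) ->
  (forall i, noetherian (R i)) ->
  (forall i, (2 <= krull_dim (R i))%N) ->
  (forall i, homogeneous_ideal (G i) (I i)) ->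
  (forall i, finite_colength (I i)) ->
  is_tensor_product tens ->
  (forall i, is_hk_density p (G i) (I i) (f i)) ->
  is_hk_density p (tensor_grading tens G) (box_ideal tens I)
    (convolution_fam f).
Proof.
move=> [pk _] sg _ dim2 hI fI tensP fP.
have dim_gt0 i : (0 < krull_dim (R i))%N by exact: ltnW.
have p1 : (1 < p)%N by apply: prime_gt1; case/andP: pk.
have Q0 e : (0 < p ^ e)%N by rewrite expn_gt0 ltnW.
have Qinf B : exists E, forall e, (E <= e)%N -> (B <= p ^ e)%N.
  exists B => e Be; apply: leq_trans Be _; apply: ltnW; exact: ltn_expl.
have sl i := density_scaled_limit pk (sg i) (hI i) (fI i) (fP i).
have [C sl0] := sl ord0.
pose us := [seq (fun e => hk_length K p (G (lift ord0 i)) (I (lift ord0 i)) e) | i : 'I_n].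
pose fs := [seq f (lift ord0 i) | i : 'I_n].
have size_us : size us = size fs by rewrite !size_map.
have us_lim i : (i < size us)%N -> exists D, scaled_limit (fun e => (p ^ e)%N)
    (nth (fun _ _ => 0) us i) (nth (fun=> 0) fs i) D.
  rewrite size_map size_enum_ord => il.
  have [D HD] := sl (lift ord0 (Ordinal il)); exists D.
  rewrite !(nth_map (Ordinal il)) -?enumT ?size_enum_ord //.
  by rewrite (nth_ord_enum (Ordinal il) (Ordinal il)).
have [D slT] := scaled_limit_fold Q0 Qinf sl0 size_us us_lim.
(* The folded sequences are the rescaled lengths of the tensor product, so the limit just obtained
   is its density. *)
have E e m : foldl (dconv (p ^ e)) (hk_length K p (G ord0) (I ord0) e) [seq w e | w <- us] m =
    hk_length K p (tensor_grading tens G) (box_ideal tens I) e m.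
  by rewrite (hk_length_tensor K pk tensP sg hI dim_gt0) -map_comp.
have [cT T0 _ uT] := slT; have TC := sl_zero Q0 slT.
split=> //.
- apply/uniform_cvgP => eps /uT[N HN]; exists N => e Ne x x0.
  by have := HN e Ne x x0; rewrite E.
- exact: compact_support T0 TC.
Qed.
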